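(* Let $\psi(\underline{x},\underline{y},\underline{a})$ be an internal formula and suppose $\textsf{M}\vdash\Psi(\underline{a})$, where $\Psi(\underline{a})\equiv(\forall^{\mathrm{st}}\underline{x})(\exists^{\mathrm{st}}\underline{y})\psi(\underline{x},\underline{y},\underline{a})$. Then there are closed monotone terms $t$ of appropriate types such that $$\textsf{E-PA}^{\omega}\vdash(\tilde\forall\underline{b})(\forall\underline{x}\le^*\underline{b})(\exists\underline{y}\le^*t(\underline{b}))\psi(\underline{x},\underline{y},\underline{a}).$$
   Context: Underlined symbols denote tuples of variables of finite types. Type $0$ is the type of natural numbers, $1$ is $0\to0$; superscripts denote types. $\textsf{E-PA}^{\omega}$ is classical Peano arithmetic in all finite types with the axiom of extensionality. Strong majorizability $\le^*$: $x\le^*_0y$ is $x\le_0y$, and $x\le^*_{\rho\to\sigma}y$ is $(\forall v)(\forall u\le^*_\rho v)(xu\le^*_\sigma yv\wedge yu\le^*_\sigma yv)$. An object $x$ is monotone if $x\le^*x$; $\tilde\forall,\tilde\exists$ denote quantifiers over monotone objects. The language of $\textsf{E-PA}^{\omega}_{\mathrm{st}}$ adds a predicate $\mathrm{st}^\sigma$ (``is standard'') for each finite type $\sigma$. A formula is internal if it does not involve $\mathrm{st}$. $(\forall^{\mathrm{st}}x)\Phi$ is $(\forall x)(\mathrm{st}(x)\to\Phi)$ and $(\exists^{\mathrm{st}}x)\Phi$ is $(\exists x)(\mathrm{st}(x)\wedge\Phi)$. $\textsf{E-PA}^{\omega}_{\mathrm{st}}$ is $\textsf{E-PA}^{\omega}$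 plus: (1) $x=_\sigma y\to(\mathrm{st}(x)\to\mathrm{st}(y))$; (2) $\mathrm{st}(y)\to(x\le^*_\sigma y\to\mathrm{st}(x))$; (3) $\mathrm{st}(t)$ for each closed term $t$; (4) $\mathrm{st}(z^{\sigma\to\tau})\to(\mathrm{st}(x^\sigma)\to\mathrm{st}(zx))$; and external induction $\Phi(0)\wedge(\forall^{\mathrm{st}}n^0)(\Phi(n)\to\Phi(n+1))\to(\forall^{\mathrm{st}}n^0)\Phi(n)$ for any $\Phi$. $\textsf{M}$ is $\textsf{E-PA}^{\omega}_{\mathrm{st}}$ plus, for internal $\varphi$: monotone choice $\textsf{mAC}^\omega_{\mathrm{st}}$: $(\tilde\forall^{\mathrm{st}}x)(\tilde\exists^{\mathrm{st}}y)\varphi(x,y)\to(\tilde\exists^{\mathrm{st}}f)(\tilde\forall^{\mathrm{st}}x)(\exists y\le^*f(x))\varphi(x,y)$; realization $\textsf{R}^\omega$: $(\forall x)(\exists^{\mathrm{st}}y)\varphi(x,y)\to(\tilde\exists^{\mathrm{st}}z)(\forall x)(\exists y\le^*z)\varphi(x,y)$; and $\textsf{MAJ}^\omega_{\mathrm{st}}$: $(\forall^{\mathrm{st}}x)(\exists^{\mathrm{st}}y)(x\le^*y)$. *)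

(* Defs.v *)
From Stdlib Require Import List.
Import ListNotations.
Set Implicit Arguments.

Inductive ty : Set :=
| N : ty
| Arr : ty -> ty -> ty.

Declare Scope ty_scope.
Delimit Scope ty_scope with ty.
Bind Scope ty_scope with ty.
Notation "r ~> s" := (Arr r s) (at level 55, right associativity) : ty_scope.
Open Scope ty_scope.

(* A context is the list of the types of the free variables, the variable bound
   last coming first.  A tuple of variables is a block of a context, so that
   [Y ++ X ++ A] is the context of a formula psi(x, y, a). *)
Definition ctx := list ty.

Inductive var : ctx -> ty -> Set :=
| vz : forall G s, var (s :: G) s
| vs : forall G r s, var G s -> var (r :: G) s.
Arguments vz {G s}.
Arguments vs {G} r {s} _.

Inductive tm (G : ctx) : ty -> Set :=
| Var : forall s, var G s -> tm G s
| App : forall r s, tm G (r ~> s) -> tm G r -> tm G s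
| Zero : tm G N
| Succ : tm G (N ~> N)
| Pi : forall r s, tm G (r ~> s ~> r)
| Sigma : forall r s q, tm G ((r ~> s ~> q) ~> (r ~> s) ~> r ~> q)
| Rec : forall s, tm G (N ~> s ~> (s ~> N ~> s) ~> s).
Arguments Zero {G}.
Arguments Succ {G}.
Arguments Pi {G} r s.
Arguments Sigma {G} r s q.
Arguments Rec {G} s.

Definition tup (W D : ctx) : Set := forall s, var W s -> tm D s.

Definition ids (G : ctx) : tup G G := fun s v => Var v.
Arguments ids {G} s _.

Fixpoint tsub (G D : ctx) (f : tup G D) (s : ty) (t : tm G s) : tm D s :=
  match t with
  | Var v => f _ v
  | App a b => App (tsub f a) (tsub f b)
  | Zero => Zero
  | Succ => Succ
  | Pi r s => Pi r s
  | Sigma r s q => Sigma r s q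
  | Rec s => Rec s
  end.

Definition wk (r : ty) (G : ctx) (s : ty) (t : tm G s) : tm (r :: G) s :=
  tsub (fun q v => Var (vs r v)) t.

Definition cl (G : ctx) (s : ty) (t : tm [] s) : tm G s :=
  tsub (fun q (v : var [] q) => match v with end) t.

Definition scons (r : ty) (G D : ctx) (t : tm D r) (f : tup G D) :
    tup (r :: G) D :=
  fun s v =>
    match v in var (r0 :: G0) s0 return tm D r0 -> tup G0 D -> tm D s0 with
    | vz => fun t _ => t
    | vs _ w => fun _ f => f _ w
    end t f.

Definition slift (r : ty) (G D : ctx) (f : tup G D) : tup (r :: G) (r :: D) :=
  scons (Var vz) (fun s v => wk r (f s v)).

Definition thead (r : ty) (W D : ctx) (u : tup (r :: W) D) : tm D r := u r vz.
Definition ttail (r : ty) (W D : ctx) (u : tup (r :: W) D) : tup W D :=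
  fun s v => u s (vs r v).

Fixpoint tcat (W G D : ctx) : tup W D -> tup G D -> tup (W ++ G) D :=
  match W return tup W D -> tup G D -> tup (W ++ G) D with
  | [] => fun _ f => f
  | r :: W' => fun u f => scons (thead u) (tcat (ttail u) f)
  end.

Fixpoint shift (W G : ctx) (s : ty) (v : var G s) : var (W ++ G) s :=
  match W return var (W ++ G) s with
  | [] => v
  | r :: W' => vs r (shift W' v)
  end.

Fixpoint inblock (W G : ctx) (s : ty) (v : var W s) : var (W ++ G) s :=
  match v in var W0 s0 return var (W0 ++ G) s0 with
  | vz => vz
  | vs r w => vs r (inblock G w)
  end.

(* [here W] is the tuple of the variables of the innermost block [W], and
   [up W] weakens a tuple of terms by a block [W]. *)
Definition here (W : ctx) (G : ctx) : tup W (W ++ G) :=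
  fun s v => Var (inblock G v).
Arguments here W {G} s _.

Definition up (W : ctx) (V G : ctx) (u : tup V G) : tup V (W ++ G) :=
  fun s v => tsub (fun q w => Var (shift W w)) (u s v).
Arguments up W {V G} u s _.

(* [arrs [x1; ..; xn] s] is x1 ~> .. ~> xn ~> s. *)
Definition arrs (X : ctx) (s : ty) : ty := fold_right Arr s X.

Fixpoint apps (X : ctx) (G : ctx) (s : ty) : tm G (arrs X s) -> tup X G -> tm G s :=
  match X return tm G (arrs X s) -> tup X G -> tm G s with
  | [] => fun t _ => t
  | r :: X' => fun t u => @apps X' G s (App t (thead u)) (ttail u)
  end.

Fixpoint vmap (h : ty -> ty) (Y : ctx) (s : ty) (v : var Y s) : var (map h Y) (h s) :=
  match v in var Y0 s0 return var (map h Y0) (h s0) with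
  | vz => vz
  | vs r w => vs (h r) (vmap h w)
  end.

(* For a tuple f of functionals, the tuple f(x) = (f1 x1 .. xn, f2 x1 .. xn, ..). *)
Definition fapp (X Y G : ctx) (f : tup (map (arrs X) Y) G) (x : tup X G) : tup Y G :=
  fun s v => @apps X _ s (f _ (vmap (arrs X) v)) x.
Arguments fapp X Y {G} f x s _.

Inductive lang : Set := Internal | External.

Definition has_st (L : lang) : Prop :=
  match L with Internal => False | External => True end.

(* The logic is classical: bottom, implication and the universal quantifier
   are primitive.  Only equality of type 0 is primitive. *)
Inductive fm (L : lang) : ctx -> Set :=
| Bot : forall G, fm L G
| Eq0 : forall G, tm G N -> tm G N -> fm L G
| St : forall G s, has_st L -> tm G s -> fm L G
| Imp : forall G, fm L G -> fm L G -> fm L G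
| All : forall G s, fm L (s :: G) -> fm L G.
Arguments Bot {L G}.
Arguments Eq0 {L G} _ _.
Arguments St {L G} s _ _.
Arguments Imp {L G} _ _.
Arguments All {L G} s _.

Definition st (G : ctx) (s : ty) (t : tm G s) : fm External G := @St External G s I t.

Section Connectives.
Variable L : lang.
Variable G : ctx.
Definition Not (p : fm L G) : fm L G := Imp p Bot.
Definition Top : fm L G := Not Bot.
Definition And (p q : fm L G) : fm L G := Not (Imp p (Not q)).
Definition Ex (s : ty) (p : fm L (s :: G)) : fm L G := Not (All s (Imp p Bot)).
End Connectives.
Arguments Top {L G}.
Arguments Ex {L G} s p.

Fixpoint fsub (L : lang) (G D : ctx) (f : tup G D) (p : fm L G) {struct p} : fm L D :=
  match p in fm _ G0 return tup G0 D -> fm L D with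
  | Bot => fun _ => Bot
  | Eq0 t u => fun f => Eq0 (tsub f t) (tsub f u)
  | St s h t => fun f => St s h (tsub f t)
  | Imp p q => fun f => Imp (fsub f p) (fsub f q)
  | All s p => fun f => All s (fsub (slift f) p)
  end f.

Definition fwk (L : lang) (r : ty) (G : ctx) (p : fm L G) : fm L (r :: G) :=
  fsub (fun q v => Var (vs r v)) p.

Definition inst (L : lang) (G : ctx) (s : ty) (p : fm L (s :: G)) (t : tm G s) : fm L G :=
  fsub (scons t ids) p.

Fixpoint emb (G : ctx) (p : fm Internal G) : fm External G :=
  match p with
  | Bot => Bot
  | Eq0 t u => Eq0 t u
  | St s h t => match h with end
  | Imp p q => Imp (emb p) (emb q)
  | All s p => All s (emb p)
  end.

Fixpoint eqt (L : lang) (s : ty) : forall G, tm G s -> tm G s -> fm L G :=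
  match s return forall G, tm G s -> tm G s -> fm L G with
  | N => fun G x y => Eq0 x y
  | r ~> q => fun G x y =>
      All r (@eqt L q _ (App (wk r x) (Var vz)) (App (wk r y) (Var vz)))
  end.
Arguments eqt {L s G} x y.

(* x + z, as R z x (fun p k => S p). *)
Definition plus (G : ctx) (x z : tm G N) : tm G N :=
  App (App (App (Rec N) z) x)
      (App (App (Sigma N N (N ~> N)) (App (Pi (N ~> N ~> N) N) (Pi N N))) Succ).

(* x <= y, as (exists z) x + z = y. *)
Definition le0 (L : lang) (G : ctx) (x y : tm G N) : fm L G :=
  Ex N (Eq0 (plus (wk N x) (Var vz)) (wk N y)).
Arguments le0 {L G} x y.

(* At type r ~> q, the first quantifier binds v and the second one u. *)
Fixpoint maj (L : lang) (s : ty) : forall G, tm G s -> tm G s -> fm L G :=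
  match s return forall G, tm G s -> tm G s -> fm L G with
  | N => fun G x y => le0 x y
  | r ~> q => fun G x y =>
      All r (All r
        (let x := wk r (wk r x) in
         let y := wk r (wk r y) in
         let v := Var (vs r vz) in
         let u := Var vz in
         Imp (@maj L r _ u v)
             (And (@maj L q _ (App x u) (App y v))
                  (@maj L q _ (App y u) (App y v)))))
  end.
Arguments maj {L s G} x y.

Fixpoint majs (L : lang) (W G : ctx) : tup W G -> tup W G -> fm L G :=
  match W return tup W G -> tup W G -> fm L G with
  | [] => fun _ _ => Top
  | r :: W' => fun x y =>
      And (maj (thead x) (thead y)) (@majs L W' G (ttail x) (ttail y))
  end.
Arguments majs {L W G} x y.

Fixpoint sts (W G : ctx) : tup W G -> fm External G :=
  match W return tup W G -> fm External G with
  | [] => fun _ => Top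
  | r :: W' => fun x => And (st (thead x)) (sts (ttail x))
  end.

Fixpoint Alls (L : lang) (W G : ctx) : fm L (W ++ G) -> fm L G :=
  match W return fm L (W ++ G) -> fm L G with
  | [] => fun p => p
  | r :: W' => fun p => @Alls L W' G (All r p)
  end.
Arguments Alls {L} W {G} p.

Fixpoint Exs (L : lang) (W G : ctx) : fm L (W ++ G) -> fm L G :=
  match W return fm L (W ++ G) -> fm L G with
  | [] => fun p => p
  | r :: W' => fun p => @Exs L W' G (Ex r p)
  end.
Arguments Exs {L} W {G} p.

Definition AllLe (L : lang) (W G : ctx) (b : tup W G) (p : fm L (W ++ G)) : fm L G :=
  Alls W (Imp (majs (here W) (up W b)) p).
Definition ExLe (L : lang) (W G : ctx) (b : tup W G) (p : fm L (W ++ G)) : fm L G :=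
  Exs W (And (majs (here W) (up W b)) p).
Definition AllMon (L : lang) (W G : ctx) (p : fm L (W ++ G)) : fm L G :=
  Alls W (Imp (majs (here W) (here W)) p).
Definition AllSt (W G : ctx) (p : fm External (W ++ G)) : fm External G :=
  Alls W (Imp (sts (here W)) p).
Definition ExSt (W G : ctx) (p : fm External (W ++ G)) : fm External G :=
  Exs W (And (sts (here W)) p).
Definition AllMonSt (W G : ctx) (p : fm External (W ++ G)) : fm External G :=
  Alls W (Imp (And (majs (here W) (here W)) (sts (here W))) p).
Definition ExMonSt (W G : ctx) (p : fm External (W ++ G)) : fm External G :=
  Exs W (And (And (majs (here W) (here W)) (sts (here W))) p).
Arguments AllMon {L} W {G} p.
Arguments AllSt W {G} p.
Arguments ExSt W {G} p.
Arguments AllMonSt W {G} p.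
Arguments ExMonSt W {G} p.

(* Classical natural deduction.  The free variables of an axiom, and of a
   formula derived from no hypotheses, are implicitly universally quantified. *)
Inductive prv (L : lang) (Ax : forall G, fm L G -> Prop) :
    forall G, list (fm L G) -> fm L G -> Prop :=
| prv_ax : forall G (H : list (fm L G)) p, Ax G p -> prv Ax H p
| prv_hyp : forall G (H : list (fm L G)) p, In p H -> prv Ax H p
| prv_impI : forall G (H : list (fm L G)) p q, prv Ax (p :: H) q -> prv Ax H (Imp p q)
| prv_impE : forall G (H : list (fm L G)) p q,
    prv Ax H (Imp p q) -> prv Ax H p -> prv Ax H q
| prv_raa : forall G (H : list (fm L G)) p, prv Ax (Not p :: H) Bot -> prv Ax H p
| prv_allI : forall G (H : list (fm L G)) s (p : fm L (s :: G)),
    prv Ax (map (@fwk L s G) H) p -> prv Ax H (All s p)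
| prv_allE : forall G (H : list (fm L G)) s (p : fm L (s :: G)) (t : tm G s),
    prv Ax H (All s p) -> prv Ax H (inst p t).

(* For p(n, a): the formula p(S n, a), in the same context. *)
Definition at_succ (L : lang) (G : ctx) (p : fm L (N :: G)) : fm L (N :: G) :=
  fsub (scons (App Succ (Var vz)) (fun s v => Var (vs N v))) p.

Inductive EPA_ax : forall G, fm Internal G -> Prop :=
| ax_refl : forall G (x : tm G N), EPA_ax (Eq0 x x)
| ax_sym : forall G (x y : tm G N), EPA_ax (Imp (Eq0 x y) (Eq0 y x))
| ax_trans : forall G (x y z : tm G N),
    EPA_ax (Imp (Eq0 x y) (Imp (Eq0 y z) (Eq0 x z)))
| ax_ext : forall G r s (z : tm G (r ~> s)) (x y : tm G r),
    EPA_ax (Imp (eqt x y) (eqt (App z x) (App z y)))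
| ax_succ_neq0 : forall G (x : tm G N), EPA_ax (Not (Eq0 (App Succ x) Zero))
| ax_succ_inj : forall G (x y : tm G N),
    EPA_ax (Imp (Eq0 (App Succ x) (App Succ y)) (Eq0 x y))
| ax_Pi : forall G r s (x : tm G r) (y : tm G s),
    EPA_ax (eqt (App (App (Pi r s) x) y) x)
| ax_Sigma : forall G r s q (x : tm G (r ~> s ~> q)) (y : tm G (r ~> s)) (z : tm G r),
    EPA_ax (eqt (App (App (App (Sigma r s q) x) y) z)
                (App (App x z) (App y z)))
| ax_Rec0 : forall G s (y : tm G s) (z : tm G (s ~> N ~> s)),
    EPA_ax (eqt (App (App (App (Rec s) Zero) y) z) y)
| ax_RecS : forall G s (x : tm G N) (y : tm G s) (z : tm G (s ~> N ~> s)),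
    EPA_ax (eqt (App (App (App (Rec s) (App Succ x)) y) z)
                (App (App z (App (App (App (Rec s) x) y) z)) x))
| ax_ind : forall G (p : fm Internal (N :: G)),
    EPA_ax (Imp (inst p Zero) (Imp (All N (Imp p (at_succ p))) (All N p))).

Inductive EPAst_ax : forall G, fm External G -> Prop :=
| ax_EPA : forall G (p : fm Internal G), EPA_ax p -> EPAst_ax (emb p)
| ax_st_eq : forall G s (x y : tm G s),
    EPAst_ax (Imp (eqt x y) (Imp (st x) (st y)))
| ax_st_maj : forall G s (x y : tm G s),
    EPAst_ax (Imp (st y) (Imp (maj x y) (st x)))
| ax_st_closed : forall G s (t : tm [] s), EPAst_ax (st (cl G t))
| ax_st_app : forall G r s (z : tm G (r ~> s)) (x : tm G r),
    EPAst_ax (Imp (st z) (Imp (st x) (st (App z x))))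
| ax_st_ind : forall G (P : fm External (N :: G)),
    EPAst_ax (Imp (inst P Zero)
                  (Imp (All N (Imp (st (Var vz)) (Imp P (at_succ P))))
                       (All N (Imp (st (Var vz)) P)))).

(* In the next two schemes x : X and y : Y are tuples. *)
Definition mAC (G X Y : ctx) (phi : fm Internal (Y ++ X ++ G)) : fm External G :=
  let F := map (arrs X) Y in
  Imp (AllMonSt X (ExMonSt Y (emb phi)))
      (ExMonSt F (AllMonSt X (ExLe (fapp X Y (up X (here F)) (here X))
        (fsub (tcat (here Y) (tcat (up Y (here X)) (up Y (up X (up F ids)))))
              (emb phi))))).

Definition Realization (G X Y : ctx) (phi : fm Internal (Y ++ X ++ G)) : fm External G :=
  Imp (Alls X (ExSt Y (emb phi)))
      (ExMonSt Y (Alls X (ExLe (up X (here Y))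
        (fsub (tcat (here Y) (tcat (up Y (here X)) (up Y (up X (up Y ids)))))
              (emb phi))))).

Definition MAJ (G : ctx) (s : ty) : fm External G :=
  All s (Imp (st (Var vz))
    (Ex s (And (st (Var vz)) (maj (Var (vs s vz)) (Var vz))))).

Inductive M_ax : forall G, fm External G -> Prop :=
| ax_EPAst : forall G (P : fm External G), EPAst_ax P -> M_ax P
| ax_mAC : forall G X Y (phi : fm Internal (Y ++ X ++ G)), M_ax (mAC G X Y phi)
| ax_R : forall G X Y (phi : fm Internal (Y ++ X ++ G)), M_ax (Realization G X Y phi)
| ax_MAJ : forall G s, M_ax (MAJ G s).

Definition EPA_proves (G : ctx) (p : fm Internal G) : Prop := prv EPA_ax [] p.
Definition M_proves (G : ctx) (P : fm External G) : Prop := prv M_ax [] P.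

Definition monotone (s : ty) (t : tm [] s) : Prop := EPA_proves (maj t t).

(* A tuple of closed terms t applied to a tuple b, i.e. t(b). *)
Definition clapp (X Y G : ctx) (t : forall s, var Y s -> tm [] (arrs X s))
    (b : tup X G) : tup Y G :=
  fun s v => @apps X _ s (cl G (t s v)) b.

(* Main.v *)
Require Import Defs.
From Stdlib Require Import List.
From Stdlib Require Import FunctionalExtensionality PropExtensionality ProofIrrelevance.
From Stdlib Require Import Classical ClassicalEpsilon.
From Stdlib Require Import Arith Lia Cantor.
Import ListNotations.
Set Implicit Arguments.

(** The proof is a bounded functional interpretation.  A formula P of the external language,
    with free variables a, is read as

      (forall st monotone b) (exists st monotone c) R(b, c, a)

    for an internal matrix R that is preserved when c increases.  Internal formulas are their
    own matrix, st(t) asks for a c with t <=* c, and a quantifier over all x is moved into the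
    matrix.  For an implication from (b, c, R) to (d, e, S) one has to compute b and e from d
    and a functional f, so that S(d, e) holds if R(b', f b') holds for all monotone b' <=* b.
    [interp] defines this, and P is [realized] if one tuple of terms computes c from b in all
    models of arithmetic, for all values of the free variables.

    Only upper bounds of c matter, so by Howard's theorem [majorant] a realizer may be replaced
    by a majorant, which is monotone.  This makes classical logic sound ([soundness]).  The one
    delicate rule is modus ponens under a hypothesis ([ent_S]), where the hypothesis is used
    many times; a join of the bounds takes care of all uses.

    The axioms are realized for simple reasons.  The interpretation of the premise of monotone
    choice already provides the choice functional.  In realization the variable x lies inside
    the matrix, so the bound for y does not depend on x.  A bound majorizes itself, which gives
    MAJ.  External induction is reduced to an induction rule, realized by simultaneous recursion
    ([ent_induction]); there the matrices have to be formulas, because a model has induction for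
    formulas only.

    If M proves the formula (forall st x) (exists st y) psi, a realizer of it is a tuple of terms
    t such that (forall x <=* b) (exists y <=* t(b)) psi holds for monotone b in all models.

    Realizers are terms, but all verification takes place in models.  Models of arithmetic can
    be taken extensional with identity as equality, and [completeness], proved by a Henkin
    construction, turns truth in all of them into derivability.  So no derivation in arithmetic
    is ever written down, and the metatheory of the functionals is ordinary mathematics about
    the elements of a model. *)

(** * Substitution *)

Lemma tup_ext W D (f g : tup W D) : (forall s v, f s v = g s v) -> f = g.
Proof.
  intro E. apply functional_extensionality_dep; intro s.
  apply functional_extensionality; intro v. apply E.
Qed.

(** Case analysis on variables as functions, so that no axiom on equality is needed to invert
    the indices, and so that environments and tuples defined by cases compute. *)
Definition var_nil (P : forall s, var [] s -> Type) s (v : var [] s) : P s v :=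
  match v in var G0 s0
    return (match G0 return var G0 s0 -> Type with
            | [] => P s0
            | _ => fun _ => unit
            end v)
  with
  | vz => tt
  | vs _ _ => tt
  end.

Definition var_cons r G (P : forall s, var (r :: G) s -> Type)
    (Pz : P r vz) (Ps : forall s (w : var G s), P s (vs r w))
    s (v : var (r :: G) s) : P s v :=
  match v in var G0 s0
    return (match G0 return var G0 s0 -> Type with
            | [] => fun _ => unit
            | r0 :: G1 => fun v => forall (P : forall s, var (r0 :: G1) s -> Type),
                P r0 vz -> (forall s (w : var G1 s), P s (vs r0 w)) -> P s0 v
            end v)
  with
  | vz => fun P Pz _ => Pz
  | vs r0 w => fun P _ Ps => Ps _ w
  end P Pz Ps.

Ltac case_var v := revert v; match goal with |- forall v : var _ ?s, _ => revert s end;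
  refine (var_cons _ _ _); [ | intros ? ?].

Lemma tsub_tsub G D E (f : tup G D) (g : tup D E) s (t : tm G s) :
  tsub g (tsub f t) = tsub (fun q v => tsub g (f q v)) t.
Proof. induction t; simpl; try reflexivity. rewrite IHt1, IHt2. reflexivity. Qed.

Lemma tsub_ids G s (t : tm G s) : tsub ids t = t.
Proof. induction t; simpl; try reflexivity. rewrite IHt1, IHt2. reflexivity. Qed.

Lemma tsub_wk G D r (f : tup (r :: G) D) s (t : tm G s) :
  tsub f (wk r t) = tsub (ttail f) t.
Proof. unfold wk. rewrite tsub_tsub. reflexivity. Qed.

Lemma wk_tsub G D r (f : tup G D) s (t : tm G s) :
  tsub (slift f) (wk r t) = wk r (tsub f t).
Proof. rewrite tsub_wk. unfold wk at 1. rewrite tsub_tsub. reflexivity. Qed.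

Lemma slift_ids r G : slift (r := r) (@ids G) = ids.
Proof. apply tup_ext. intros s v. case_var v; reflexivity. Qed.

Lemma slift_comp r G D E (f : tup G D) (g : tup D E) :
  (fun q v => tsub (slift (r := r) g) (slift f v)) = slift (fun q v => tsub g (f q v)).
Proof.
  apply tup_ext. intros s v. case_var v; [reflexivity|]. apply wk_tsub.
Qed.

Lemma scons_comp r G D E (t : tm D r) (f : tup G D) (g : tup D E) :
  (fun q v => tsub g (scons t f v)) = scons (tsub g t) (fun q v => tsub g (f q v)).
Proof. apply tup_ext. intros s v. case_var v; reflexivity. Qed.

Lemma slift_scons r G D E (f : tup G D) (t : tm E r) (g : tup D E) :
  (fun q v => tsub (scons t g) (slift f v)) = scons t (fun q v => tsub g (f q v)).
Proof. apply tup_ext. intros s v. case_var v; [reflexivity|]. simpl. apply tsub_wk. Qed.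

Lemma fsub_fsub L G D E (p : fm L G) (f : tup G D) (g : tup D E) :
  fsub g (fsub f p) = fsub (fun q v => tsub g (f q v)) p.
Proof.
  revert D E f g. induction p; intros; simpl; f_equal; auto using tsub_tsub.
  rewrite IHp, slift_comp. reflexivity.
Qed.

Lemma fsub_ids L G (p : fm L G) : fsub ids p = p.
Proof. induction p; simpl; f_equal; auto using tsub_ids. rewrite slift_ids; auto. Qed.

Lemma fsub_inst L G D s (f : tup G D) (p : fm L (s :: G)) (t : tm G s) :
  fsub f (inst p t) = inst (fsub (slift f) p) (tsub f t).
Proof.
  unfold inst. rewrite !fsub_fsub. f_equal. rewrite scons_comp, slift_scons.
  f_equal. apply tup_ext. intros. simpl. symmetry. apply tsub_ids.
Qed.

Lemma fsub_fwk L G D r (f : tup G D) (p : fm L G) :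
  fsub (slift f) (fwk r p) = fwk r (fsub f p).
Proof. unfold fwk. rewrite !fsub_fsub. reflexivity. Qed.

Lemma inst_fwk L G r (p : fm L G) (t : tm G r) : inst (fwk r p) t = p.
Proof. unfold inst, fwk. rewrite fsub_fsub. apply fsub_ids. Qed.

Lemma fsub_at_succ L G D (f : tup G D) (p : fm L (N :: G)) :
  fsub (slift f) (at_succ p) = at_succ (fsub (slift f) p).
Proof.
  unfold at_succ. rewrite !fsub_fsub, scons_comp, slift_scons. reflexivity.
Qed.

Lemma fsub_eqt L s G D (f : tup G D) (x y : tm G s) :
  fsub f (eqt (L := L) x y) = eqt (tsub f x) (tsub f y).
Proof.
  revert G D f x y. induction s; intros; simpl; [reflexivity|].
  rewrite IHs2. simpl. rewrite !wk_tsub. reflexivity.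
Qed.

Lemma EPA_ax_fsub G D (f : tup G D) p : EPA_ax p -> EPA_ax (fsub f p).
Proof.
  destruct 1; simpl; rewrite ?fsub_eqt, ?fsub_inst, ?fsub_at_succ; constructor.
Qed.

(** * Internal formulas in the external language *)

Lemma emb_fsub G (p : fm Internal G) : forall D (f : tup G D), emb (fsub f p) = fsub f (emb p).
Proof.
  induction p; intros D f; simpl; try reflexivity.
  - destruct h.
  - rewrite IHp1, IHp2. reflexivity.
  - rewrite IHp. reflexivity.
Qed.

Lemma emb_eqt s : forall G (x y : tm G s), emb (eqt x y) = eqt x y.
Proof. induction s; intros; [reflexivity|]. cbn. rewrite IHs2. reflexivity. Qed.

Lemma emb_maj s : forall G (x y : tm G s), emb (maj x y) = maj x y.
Proof. induction s; intros; [reflexivity|]. cbn. rewrite IHs1, !IHs2. reflexivity. Qed.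

Lemma emb_majs W G (x y : tup W G) : emb (majs x y) = majs x y.
Proof. induction W; [reflexivity|]. cbn. rewrite emb_maj, IHW. reflexivity. Qed.

Lemma emb_Exs W G (p : fm Internal (W ++ G)) : emb (Exs W p) = Exs W (emb p).
Proof. revert p. induction W; intro p; [reflexivity|]. cbn [Exs]. rewrite IHW. reflexivity. Qed.

Lemma emb_ExLe W G (b : tup W G) (p : fm Internal (W ++ G)) : emb (ExLe b p) = ExLe b (emb p).
Proof. unfold ExLe. rewrite emb_Exs. cbn. rewrite emb_majs. reflexivity. Qed.

(** * Derivations *)

Lemma prv_weaken L (Ax : forall G, fm L G -> Prop) G (H : list (fm L G)) p :
  prv Ax H p -> forall H', incl H H' -> prv Ax H' p.
Proof.
  induction 1; intros H' I.
  - apply prv_ax; auto.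
  - apply prv_hyp; auto.
  - apply prv_impI. apply IHprv. intros x [<-|Hx]; [left|right]; auto.
  - eapply prv_impE; eauto.
  - apply prv_raa. apply IHprv. intros x [<-|Hx]; [left|right]; auto.
  - apply prv_allI. apply IHprv. apply incl_map. auto.
  - apply prv_allE; auto.
Qed.

(** Needed to carry a derivation to a later stage of the construction of a model, where there
    are more variables. *)
Lemma prv_fsub L (Ax : forall G, fm L G -> Prop)
    (AxS : forall G D (f : tup G D) p, Ax G p -> Ax D (fsub f p))
    G (H : list (fm L G)) p :
  prv Ax H p -> forall D (f : tup G D), prv Ax (map (fsub f) H) (fsub f p).
Proof.
  induction 1; intros D f; simpl in *.
  - apply prv_ax; auto.
  - apply prv_hyp. apply in_map; auto.
  - apply prv_impI. apply IHprv.
  - eapply prv_impE; eauto.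
  - apply prv_raa. apply IHprv.
  - apply prv_allI. rewrite map_map.
    erewrite map_ext; [|intro; symmetry; apply fsub_fwk].
    rewrite <- map_map. apply IHprv.
  - rewrite fsub_inst. apply prv_allE. apply IHprv.
Qed.

Lemma prv_cut L (Ax : forall G, fm L G -> Prop) G (H : list (fm L G)) p q :
  prv Ax H p -> prv Ax (p :: H) q -> prv Ax H q.
Proof. intros A B. eapply prv_impE; [apply prv_impI, B | exact A]. Qed.

Lemma prv_exfalso L (Ax : forall G, fm L G -> Prop) G (H : list (fm L G)) p :
  prv Ax H Bot -> prv Ax H p.
Proof.
  intro A. apply prv_raa. apply prv_weaken with H; auto. intros x; right; auto.
Qed.

(** A fresh variable can be instantiated again, since every type has a term, [dflt]. *)
Lemma prv_strengthen L (Ax : forall G, fm L G -> Prop) G r (H : list (fm L G)) p (t : tm G r) :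
  prv Ax (map (@fwk L r G) H) (fwk r p) -> prv Ax H p.
Proof. intro A. rewrite <- (inst_fwk p t). apply prv_allE, prv_allI, A. Qed.

Fixpoint dflt (G : ctx) (s : ty) : tm G s :=
  match s with
  | N => Zero
  | r ~> q => App (Pi q r) (dflt G q)
  end.

(** * Models of arithmetic in all finite types *)

Record structure := {
  dom : ty -> Type;
  ap : forall r s, dom (r ~> s) -> dom r -> dom s;
  zero : dom N;
  succ : dom (N ~> N);
  kpi : forall r s, dom (r ~> s ~> r);
  ksigma : forall r s q, dom ((r ~> s ~> q) ~> (r ~> s) ~> r ~> q);
  krec : forall s, dom (N ~> s ~> (s ~> N ~> s) ~> s)
}.
Arguments ap {_ r s} _ _.
Arguments zero {_}.
Arguments succ {_}.

Definition env (M : structure) (G : ctx) := forall s, var G s -> dom M s.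

Definition enil (M : structure) : env M [] := var_nil _.
Definition econs M r G (x : dom M r) (e : env M G) : env M (r :: G) :=
  var_cons (fun s _ => dom M s) x (fun s w => e s w).
Definition ehd M r G (e : env M (r :: G)) : dom M r := e r vz.
Definition etl M r G (e : env M (r :: G)) : env M G := fun s v => e s (vs r v).

Fixpoint ecat M W G : env M W -> env M G -> env M (W ++ G) :=
  match W return env M W -> env M G -> env M (W ++ G) with
  | [] => fun _ e => e
  | r :: W' => fun w e => econs (ehd w) (ecat (etl w) e)
  end.
Definition efst M W G (e : env M (W ++ G)) : env M W := fun s v => e s (inblock G v).
Definition esnd M W G (e : env M (W ++ G)) : env M G := fun s v => e s (shift W v).
Arguments efst {M} W {G} e s _.
Arguments esnd {M} W {G} e s _.

Fixpoint evt M G s (t : tm G s) (e : env M G) : dom M s :=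
  match t with
  | Var v => e _ v
  | App a b => ap (evt a e) (evt b e)
  | Zero => zero
  | Succ => succ
  | Pi r s => kpi M r s
  | Sigma r s q => ksigma M r s q
  | Rec s => krec M s
  end.

Definition evs M W G (f : tup W G) (e : env M G) : env M W := fun s v => evt (f s v) e.

Fixpoint evf M G (p : fm Internal G) : env M G -> Prop :=
  match p in fm _ G0 return env M G0 -> Prop with
  | Bot => fun _ => False
  | Eq0 t u => fun e => evt t e = evt u e
  | St s h t => match h with end
  | Imp p q => fun e => evf p e -> evf q e
  | All s p => fun e => forall x : dom M s, evf p (econs x e)
  end.

(** Equality of type 0 is interpreted by identity and functionals are determined by their
    values, so equality of every type is identity.  No generality is lost, since any other model
    can be divided by extensional equality, which the axioms make a congruence. *)
Record model := {
  mstr :> structure;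
  mext : forall r s (f g : dom mstr (r ~> s)), (forall x, ap f x = ap g x) -> f = g;
  mtrue : forall G (p : fm Internal G) (e : env mstr G), EPA_ax p -> evf p e
}.

Lemma env_ext (M : structure) G (a b : env M G) : (forall s v, a s v = b s v) -> a = b.
Proof.
  intro E. apply functional_extensionality_dep; intro s.
  apply functional_extensionality; intro v. apply E.
Qed.

Lemma env_nil (M : structure) (a b : env M []) : a = b.
Proof. apply env_ext. refine (var_nil _). Qed.

Lemma econs_eta (M : structure) r G (e : env M (r :: G)) : econs (ehd e) (etl e) = e.
Proof. apply env_ext. intros s v. case_var v; reflexivity. Qed.

Lemma etl_econs (M : structure) r G (x : dom M r) (e : env M G) : etl (econs x e) = e.
Proof. reflexivity. Qed.

Lemma efst_ecat (M : structure) W G (w : env M W) (e : env M G) : efst W (ecat w e) = w.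
Proof.
  apply env_ext. intros s v. unfold efst. induction v; simpl; [reflexivity|].
  apply (IHv (etl w)).
Qed.

Lemma esnd_ecat (M : structure) W G (w : env M W) (e : env M G) : esnd W (ecat w e) = e.
Proof.
  apply env_ext. intros s v. unfold esnd. induction W; simpl; [reflexivity|].
  apply (IHW (etl w)).
Qed.

Lemma ecat_eta (M : structure) W G (e : env M (W ++ G)) : ecat (efst W e) (esnd W e) = e.
Proof.
  induction W; simpl; [reflexivity|].
  refine (eq_trans _ (econs_eta (G := W ++ G) e)).
  apply (f_equal (econs (ehd (G := W ++ G) e))), (IHW (etl (G := W ++ G) e)).
Qed.

Lemma evt_tsub M G D (f : tup G D) s (t : tm G s) (e : env M D) :
  evt (tsub f t) e = evt t (evs f e).
Proof. induction t; simpl; try reflexivity. rewrite IHt1, IHt2. reflexivity. Qed.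

Lemma evt_wk M G r s (t : tm G s) (e : env M (r :: G)) :
  evt (wk r t) e = evt t (etl e).
Proof. apply evt_tsub. Qed.

Lemma evt_cl M G s (t : tm [] s) (e : env M G) : evt (cl G t) e = evt t (enil M).
Proof. unfold cl. rewrite evt_tsub. f_equal. apply env_nil. Qed.

Lemma evs_scons M W r G (t : tm G r) (f : tup W G) (e : env M G) :
  evs (scons t f) e = econs (evt t e) (evs f e).
Proof. apply env_ext. intros s v. case_var v; reflexivity. Qed.

Lemma evs_slift M G D r (f : tup G D) (x : dom M r) (e : env M D) :
  evs (slift f) (econs x e) = econs x (evs f e).
Proof.
  apply env_ext. intros s v. case_var v; [reflexivity|].
  unfold evs. simpl. rewrite evt_wk. reflexivity.
Qed.

Lemma evs_tcat M W G D (u : tup W D) (f : tup G D) (e : env M D) :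
  evs (tcat u f) e = ecat (evs u e) (evs f e).
Proof.
  induction W; simpl; [reflexivity|]. rewrite evs_scons, IHW. reflexivity.
Qed.

Lemma evs_here M W G (e : env M (W ++ G)) : evs (here W) e = efst W e.
Proof. reflexivity. Qed.

Lemma evs_up M W V G (u : tup V G) (e : env M (W ++ G)) :
  evs (up W u) e = evs u (esnd W e).
Proof. apply env_ext. intros. unfold evs, up. rewrite evt_tsub. reflexivity. Qed.

Lemma forall_eq A (P Q : A -> Prop) :
  (forall x, P x = Q x) -> (forall x, P x) = (forall x, Q x).
Proof. intro E. apply functional_extensionality in E. rewrite E. reflexivity. Qed.

Lemma evf_fsub M G (p : fm Internal G) : forall D (f : tup G D) (e : env M D),
  evf (fsub f p) e = evf p (evs f e).
Proof.
  induction p; intros D f e; simpl.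
  - reflexivity.
  - rewrite !evt_tsub. reflexivity.
  - destruct h.
  - rewrite IHp1, IHp2. reflexivity.
  - apply forall_eq. intro x. rewrite IHp, evs_slift. reflexivity.
Qed.

Lemma evf_inst M G s (p : fm Internal (s :: G)) (t : tm G s) (e : env M G) :
  evf (inst p t) e = evf p (econs (evt t e) e).
Proof. unfold inst. rewrite evf_fsub, evs_scons. reflexivity. Qed.

Lemma evf_at_succ M G (p : fm Internal (N :: G)) x (e : env M G) :
  evf (at_succ p) (econs x e) = evf p (econs (ap succ x) e).
Proof. unfold at_succ. rewrite evf_fsub, evs_scons. reflexivity. Qed.

Lemma evf_And M G (p q : fm Internal G) (e : env M G) :
  evf (And p q) e <-> evf p e /\ evf q e.
Proof. simpl. tauto. Qed.

Lemma evf_Ex M G s (p : fm Internal (s :: G)) (e : env M G) :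
  evf (Ex s p) e <-> exists x, evf p (econs x e).
Proof.
  simpl. split.
  - intro A. apply NNPP. intro B. apply A. intros x C. apply B. exists x; auto.
  - intros [x A] B. exact (B x A).
Qed.

Lemma evf_Alls M W G (p : fm Internal (W ++ G)) (e : env M G) :
  evf (Alls W p) e <-> forall w, evf p (ecat w e).
Proof.
  revert p. induction W; intro p; simpl.
  - split; intro A; [intros; exact A | exact (A (enil M))].
  - rewrite IHW. simpl. split; intro A.
    + intro w. apply A.
    + intros w x. apply (A (econs x w)).
Qed.

Lemma evf_Exs M W G (p : fm Internal (W ++ G)) (e : env M G) :
  evf (Exs W p) e <-> exists w, evf p (ecat w e).
Proof.
  revert p. induction W; intro p.
  - simpl. split; [intro A; exists (enil M); exact A | intros [w A]; exact A].
  - cbn [Exs]. rewrite IHW. split.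
    + intros [w A]. apply evf_Ex in A. destruct A as [x A]. exists (econs x w). exact A.
    + intros [w A]. exists (etl w). apply evf_Ex. exists (ehd w). exact A.
Qed.

Section Model.
Variable M : model.

Lemma evf_eqt s : forall G (x y : tm G s) (e : env M G),
  evf (eqt x y) e <-> evt x e = evt y e.
Proof.
  induction s; intros; simpl; [tauto|]. split; intro A.
  - apply mext. intro z. specialize (A z). apply IHs2 in A. simpl in A.
    rewrite !evt_wk in A. exact A.
  - intro z. apply IHs2. simpl. rewrite !evt_wk. simpl. rewrite !etl_econs, A. reflexivity.
Qed.

Notation e1 x := (econs x (enil M)).
Let v0 {s G} : tm (s :: G) s := Var vz.
Let v1 {r s G} : tm (r :: s :: G) s := Var (vs r vz).
Let v2 {q r s G} : tm (q :: r :: s :: G) s := Var (vs q (vs r vz)).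

Lemma m_pi r s x y : ap (ap (kpi M r s) x) y = x.
Proof.
  pose proof (mtrue M (econs x (e1 y)) (ax_Pi v0 v1)) as A. apply evf_eqt in A. exact A.
Qed.

Lemma m_sigma r s q x y z :
  ap (ap (ap (ksigma M r s q) x) y) z = ap (ap x z) (ap y z).
Proof.
  pose proof (mtrue M (econs x (econs y (e1 z))) (ax_Sigma v0 v1 v2)) as A.
  apply evf_eqt in A. exact A.
Qed.

Lemma m_rec0 s y z : ap (ap (ap (krec M s) zero) y) z = y.
Proof.
  pose proof (mtrue M (econs y (e1 z)) (ax_Rec0 v0 v1)) as A. apply evf_eqt in A. exact A.
Qed.

Lemma m_recS s x y z :
  ap (ap (ap (krec M s) (ap succ x)) y) z
  = ap (ap z (ap (ap (ap (krec M s) x) y) z)) x.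
Proof.
  pose proof (mtrue M (econs x (econs y (e1 z))) (ax_RecS v0 v1 v2)) as A.
  apply evf_eqt in A. exact A.
Qed.

Lemma m_ind G (p : fm Internal (N :: G)) (e : env M G) : evf p (econs zero e) ->
  (forall n, evf p (econs n e) -> evf p (econs (ap succ n) e)) ->
  forall n, evf p (econs n e).
Proof.
  intros A B. pose proof (mtrue M e (ax_ind p)) as C. simpl in C. apply C.
  - rewrite evf_inst. exact A.
  - intros m. rewrite evf_at_succ. apply B.
Qed.

End Model.

(** * Completeness of arithmetic for its models *)

Definition ty_dec (r s : ty) : {r = s} + {r <> s}.
Proof. decide equality. Defined.

(** The construction of a model runs through all formulas, so they have to be enumerated.  The
    lists with index n grow with n and exhaust the types, the terms and the formulas. *)
Fixpoint tys (n : nat) : list ty :=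
  match n with
  | 0 => []
  | S n => [N] ++ flat_map (fun r => map (Arr r) (tys n)) (tys n) ++ tys n
  end.

Definition of_type (F : ty -> Set) (s : ty) (l : list {q & F q}) : list (F s) :=
  flat_map (fun x => match ty_dec (projT1 x) s with
                     | left e => [eq_rect _ F (projT2 x) s e]
                     | right _ => []
                     end) l.

Arguments of_type {F} s l.

Fixpoint vars (G : ctx) : list {s & var G s} :=
  match G with
  | [] => []
  | r :: G => existT _ r vz :: map (fun x => existT _ (projT1 x) (vs r (projT2 x))) (vars G)
  end.

Definition atoms (n : nat) (G : ctx) : list {s & tm G s} :=
  map (fun x => existT (tm G) (projT1 x) (Var (projT2 x))) (vars G) ++
  [existT _ _ Zero; existT _ _ Succ] ++
  flat_map (fun r => existT (tm G) _ (Rec r) ::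
    flat_map (fun s => existT (tm G) _ (Pi r s) ::
      map (fun q => existT (tm G) _ (Sigma r s q)) (tys n)) (tys n)) (tys n).

Fixpoint tms (n : nat) (G : ctx) (s : ty) : list (tm G s) :=
  match n with
  | 0 => []
  | S n => of_type s (atoms n G) ++
      flat_map (fun r => flat_map (fun a => map (App a) (tms n G r)) (tms n G (r ~> s)))
        (tys n) ++ tms n G s
  end.

Fixpoint fms (n : nat) (G : ctx) : list (fm Internal G) :=
  match n with
  | 0 => []
  | S n => [Bot] ++ flat_map (fun a => map (Eq0 a) (tms n G N)) (tms n G N) ++
      flat_map (fun p => map (Imp p) (fms n G)) (fms n G) ++
      flat_map (fun s => map (All s) (fms n (s :: G))) (tys n) ++ fms n G
  end.

Lemma mono_le A (L : nat -> list A) : (forall n x, In x (L n) -> In x (L (S n))) ->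
  forall n m x, n <= m -> In x (L n) -> In x (L m).
Proof. intros S n m x H. induction H; auto. Qed.

Lemma tys_le n m s : n <= m -> In s (tys n) -> In s (tys m).
Proof. apply mono_le. intros. simpl. rewrite in_app_iff. auto. Qed.

Lemma tms_le G s n m (t : tm G s) : n <= m -> In t (tms n G s) -> In t (tms m G s).
Proof.
  apply mono_le with (L := fun n => tms n G s). intros. simpl. rewrite !in_app_iff. auto.
Qed.

Lemma fms_le G n m (p : fm Internal G) : n <= m -> In p (fms n G) -> In p (fms m G).
Proof.
  apply mono_le with (L := fun n => fms n G). intros. simpl. rewrite !in_app_iff. auto.
Qed.

Lemma tys_all s : exists n, In s (tys n).
Proof.
  induction s as [|r [n Hr] s [m Hs]].
  - exists 1. simpl. auto.
  - exists (S (n + m)). simpl. right. rewrite in_app_iff. left.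
    apply in_flat_map. exists r. split; [eapply tys_le; [|exact Hr]; lia|].
    apply in_map. eapply tys_le; [|exact Hs]; lia.
Qed.

Lemma of_type_In (F : ty -> Set) s (x : F s) l : In (existT F s x) l -> In x (of_type s l).
Proof.
  intro H. apply in_flat_map. exists (existT F s x). split; [exact H|]. simpl.
  destruct (ty_dec s s) as [e|]; [|congruence].
  rewrite (proof_irrelevance _ e eq_refl). simpl. auto.
Qed.

Lemma vars_all G s (v : var G s) : In (existT _ s v) (vars G).
Proof.
  induction v; simpl; [auto|]. right.
  apply (in_map (fun x => existT _ (projT1 x) (vs r (projT2 x))) _ _ IHv).
Qed.

Lemma atoms_In n G s (t : tm G s) : In (existT _ s t) (atoms n G) -> In t (tms (S n) G s).
Proof. intro H. simpl. rewrite in_app_iff. left. apply of_type_In, H. Qed.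

Lemma tms_all G s (t : tm G s) : exists n, In t (tms n G s).
Proof.
  induction t as [s v|r s a [n Ha] b [m Hb]| | |r s|r s q|s].
  - exists 1. apply atoms_In. unfold atoms. rewrite in_app_iff. left.
    apply (in_map (fun x => existT (tm G) (projT1 x) (Var (projT2 x))) _ _ (vars_all v)).
  - destruct (tys_all r) as [k Hr]. exists (S (n + m + k)). simpl.
    rewrite !in_app_iff. right. left. apply in_flat_map. exists r.
    split; [eapply tys_le; [|exact Hr]; lia|]. apply in_flat_map. exists a.
    split; [eapply tms_le; [|exact Ha]; lia|]. apply in_map.
    eapply tms_le; [|exact Hb]; lia.
  - exists 1. apply atoms_In. unfold atoms. rewrite !in_app_iff. simpl. auto.
  - exists 1. apply atoms_In. unfold atoms. rewrite !in_app_iff. simpl. auto.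
  - destruct (tys_all r) as [n Hr], (tys_all s) as [m Hs]. exists (S (n + m)).
    apply atoms_In. unfold atoms. rewrite !in_app_iff. right. right.
    apply in_flat_map. exists r. split; [eapply tys_le; [|exact Hr]; lia|]. right.
    apply in_flat_map. exists s. split; [eapply tys_le; [|exact Hs]; lia|]. left.
    reflexivity.
  - destruct (tys_all r) as [n Hr], (tys_all s) as [m Hs], (tys_all q) as [k Hq].
    exists (S (n + m + k)). apply atoms_In. unfold atoms. rewrite !in_app_iff. right. right.
    apply in_flat_map. exists r. split; [eapply tys_le; [|exact Hr]; lia|]. right.
    apply in_flat_map. exists s. split; [eapply tys_le; [|exact Hs]; lia|]. right.
    apply (in_map (fun q => existT (tm G) _ (Sigma r s q))).
    eapply tys_le; [|exact Hq]; lia.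
  - destruct (tys_all s) as [n Hs]. exists (S n). apply atoms_In. unfold atoms.
    rewrite !in_app_iff. right. right. apply in_flat_map. exists s. simpl. auto.
Qed.

Lemma fms_all G (p : fm Internal G) : exists n, In p (fms n G).
Proof.
  induction p as [G|G a b|G s h t|G p [n Hp] q [m Hq]|G s p [n Hp]].
  - exists 1. simpl. auto.
  - destruct (tms_all a) as [n Ha], (tms_all b) as [m Hb]. exists (S (n + m)). simpl.
    right. rewrite !in_app_iff. left. apply in_flat_map. exists a.
    split; [eapply tms_le; [|exact Ha]; lia|]. apply in_map.
    eapply tms_le; [|exact Hb]; lia.
  - destruct h.
  - exists (S (n + m)).
    simpl. right. rewrite !in_app_iff. right. left. apply in_flat_map. exists p.
    split; [eapply fms_le; [|exact Hp]; lia|]. apply in_map.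
    eapply fms_le; [|exact Hq]; lia.
  - destruct (tys_all s) as [m Hs]. exists (S (n + m)).
    simpl. right. rewrite !in_app_iff. right. right. left. apply in_flat_map. exists s.
    split; [eapply tys_le; [|exact Hs]; lia|]. apply in_map.
    eapply fms_le; [|exact Hp]; lia.
Qed.

Definition enum A (d : A) (L : nat -> list A) (j : nat) : A :=
  let (n, k) := of_nat j in nth k (L n) d.

Lemma enum_all A (d : A) L x : (exists n, In x (L n)) -> exists j, enum d L j = x.
Proof.
  intros [n H]. apply In_nth with (d := d) in H. destruct H as [k [_ H]].
  exists (to_nat (n, k)). unfold enum. rewrite cancel_of_to. exact H.
Qed.

Definition nth_ty := enum N tys.
Definition nth_fm G := enum (@Bot Internal G) (fun n => fms n G).

Lemma nth_ty_all s : exists j, nth_ty j = s.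
Proof. apply enum_all, tys_all. Qed.

Lemma nth_fm_all G p : exists j, nth_fm G j = p.
Proof. apply enum_all. apply fms_all. Qed.

Definition consistent G (H : list (fm Internal G)) := ~ prv EPA_ax H Bot.

Section Henkin.
Variable G0 : ctx.
Variable H0 : list (fm Internal G0).

(** The witness that stage n adds is a variable of type [tau n].  The number n codes a triple of
    a type, an earlier stage and a formula of that stage with an additional variable of that
    type; since the type is read off n alone, the contexts do not depend on the theories. *)
Definition tau (n : nat) : ty := nth_ty (fst (of_nat n)).

Fixpoint hctx (n : nat) : ctx :=
  match n with
  | 0 => G0
  | S n => tau n :: hctx n
  end.

(** Weakening from stage [m] to stage [n].  It is total in both, with junk values for
    [n < m], so that no proof of [m <= n] has to be carried around. *)
Fixpoint lft (m n : nat) : tup (hctx m) (hctx n) :=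
  match Nat.eq_dec m n with
  | left e => eq_rect m (fun k => tup (hctx m) (hctx k)) ids n e
  | right _ =>
      match n return tup (hctx m) (hctx n) with
      | 0 => fun s _ => dflt _ s
      | S k => fun s v => wk (tau k) (lft m k v)
      end
  end.

Definition decided (n : nat) : fm Internal (hctx n) :=
  let (m, j) := of_nat n in fsub (lft m n) (nth_fm (hctx m) j).

Definition witnessed (n : nat) : fm Internal (tau n :: hctx n) :=
  let (m, j) := of_nat (snd (of_nat n)) in
  fsub (slift (lft m n)) (nth_fm (tau n :: hctx m) j).

(** The Henkin axiom: the new variable is a counterexample if there is one. *)
Definition henkin (n : nat) : fm Internal (hctx (S n)) :=
  Imp (witnessed n) (fwk (tau n) (All (tau n) (witnessed n))).

Definition decide n (H : list (fm Internal (hctx n))) : fm Internal (hctx n) :=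
  if excluded_middle_informative (consistent (decided n :: H))
  then decided n else Not (decided n).

Fixpoint theory (n : nat) : list (fm Internal (hctx n)) :=
  match n return list (fm Internal (hctx n)) with
  | 0 => H0
  | S n => henkin n :: map (@fwk Internal (tau n) (hctx n)) (decide n (theory n) :: theory n)
  end.

Hypothesis cons0 : consistent H0.

Lemma decide_consistent n H : consistent H -> consistent (decide n H :: H).
Proof.
  intro C. unfold decide. destruct excluded_middle_informative as [D|D]; [exact D|].
  intro A. apply D. intro B. apply C. eapply prv_cut; [apply prv_raa, A | exact B].
Qed.

(** If the Henkin axiom p(c) -> (forall x) p(x) is refuted, then p(c) holds and (forall x) p(x)
    fails; but c is fresh, so the former is a proof of (forall x) p(x). *)
Lemma henkin_consistent G s (p : fm Internal (s :: G)) H : consistent H ->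
  consistent (Imp p (fwk s (All s p)) :: map (@fwk Internal s G) H).
Proof.
  intros C A. apply C.
  assert (P : prv EPA_ax (map (@fwk Internal s G) H) p).
  { apply prv_raa. apply prv_cut with (Imp p (fwk s (All s p))).
    - apply prv_impI, prv_exfalso. apply prv_impE with p; apply prv_hyp; simpl; auto.
    - apply prv_weaken with (1 := A). intros x [<-|Hx]; simpl; auto. }
  assert (Q : prv EPA_ax (map (@fwk Internal s G) H) (Not (fwk s (All s p)))).
  { apply prv_impI. apply prv_cut with (Imp p (fwk s (All s p))).
    - apply prv_impI. apply prv_hyp. simpl. auto.
    - apply prv_weaken with (1 := A). intros x [<-|Hx]; simpl; auto. }
  apply prv_impE with (All s p); [|apply prv_allI, P].
  apply (@prv_strengthen _ EPA_ax G s H (Not (All s p)) (dflt G s)), Q.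
Qed.

Lemma theory_consistent n : consistent (theory n).
Proof.
  induction n; [exact cons0|]. apply henkin_consistent, decide_consistent, IHn.
Qed.

Lemma lft_refl n : lft n n = ids.
Proof.
  destruct n; simpl; [reflexivity|]. destruct Nat.eq_dec as [e|]; [|congruence].
  rewrite (proof_irrelevance _ e eq_refl). reflexivity.
Qed.

Lemma lft_S m n : m <= n -> lft m (S n) = fun s v => wk (tau n) (lft m n v).
Proof. intro H. simpl. destruct Nat.eq_dec as [e|]; [lia|reflexivity]. Qed.

Lemma lft_lft m n k s (v : var (hctx m) s) : m <= n -> n <= k ->
  tsub (lft n k) (lft m n v) = lft m k v.
Proof.
  intros A B. induction B.
  - rewrite lft_refl. apply tsub_ids.
  - rewrite !lft_S by lia. rewrite <- IHB. unfold wk. rewrite tsub_tsub. reflexivity.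
Qed.

Lemma tsub_lft m n k s (t : tm (hctx m) s) : m <= n -> n <= k ->
  tsub (lft n k) (tsub (lft m n) t) = tsub (lft m k) t.
Proof.
  intros A B. rewrite tsub_tsub. f_equal. apply tup_ext. intros. apply lft_lft; auto.
Qed.

Lemma fsub_lft m n k (p : fm Internal (hctx m)) : m <= n -> n <= k ->
  fsub (lft n k) (fsub (lft m n) p) = fsub (lft m k) p.
Proof.
  intros A B. rewrite fsub_fsub. f_equal. apply tup_ext. intros. apply lft_lft; auto.
Qed.

Lemma theory_le m n p : m <= n -> In p (theory m) -> In (fsub (lft m n) p) (theory n).
Proof.
  intros A H. induction A.
  - rewrite lft_refl, fsub_ids. exact H.
  - rewrite <- (@fsub_lft m m0 (S m0)) by lia. simpl theory. right. right.
    rewrite (@lft_S m0 m0), lft_refl by lia. apply in_map. exact IHA.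
Qed.

(** Truth in the limit of the theories.  It is given by membership, which is preserved from
    stage to stage, and it is closed under derivability because every formula is decided at
    some stage. *)
Definition holds m (p : fm Internal (hctx m)) :=
  exists n, m <= n /\ In (fsub (lft m n) p) (theory n).
Arguments holds {m} p.

Lemma holds_dec m (p : fm Internal (hctx m)) : holds p \/ holds (Not p).
Proof.
  destruct (nth_fm_all p) as [j Hj]. set (n := to_nat (m, j)).
  assert (A : m <= n) by (pose proof (to_nat_non_decreasing m j); unfold n; lia).
  assert (E : decided n = fsub (lft m n) p).
  { unfold decided, n. rewrite cancel_of_to, Hj. reflexivity. }
  assert (B : In (fwk (tau n) (decide n (theory n))) (theory (S n))) by (simpl; auto).
  unfold decide in B. rewrite E in B.
  destruct excluded_middle_informative; [left|right]; exists (S n); split; try lia;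
    rewrite <- (@fsub_lft m n (S n)) by lia;
    rewrite (@lft_S n n), lft_refl by lia; exact B.
Qed.

Lemma holds_In m n (l : list (fm Internal (hctx m))) : m <= n ->
  (forall p, In p l -> holds p) -> exists k, n <= k /\ incl (map (fsub (lft m k)) l) (theory k).
Proof.
  intros A H. induction l as [|p l IH].
  - exists n. split; [lia|]. intros x [].
  - destruct IH as [k [B I]]; [intros; apply H; right; auto|].
    destruct (H p) as [k' [B' I']]; [left; auto|].
    exists (k + k'). split; [lia|]. intros x [<-|Hx].
    + rewrite <- (@fsub_lft m k' (k + k')) by lia. apply theory_le; [lia|auto].
    + apply in_map_iff in Hx. destruct Hx as [y [<- Hy]].
      rewrite <- (@fsub_lft m k (k + k')) by lia. apply theory_le; [lia|].
      apply I, in_map, Hy.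
Qed.

Lemma holds_prv m l (p : fm Internal (hctx m)) : prv EPA_ax l p ->
  (forall q, In q l -> holds q) -> holds p.
Proof.
  intros D H. destruct (holds_dec m p) as [A|A]; [exact A|exfalso].
  destruct (@holds_In m m (Not p :: l)) as [k [B I]]; [lia| |].
  { intros q [<-|Hq]; auto. }
  apply (@theory_consistent k).
  apply prv_fsub with (f := lft m k) in D; [|exact EPA_ax_fsub].
  apply prv_impE with (fsub (lft m k) p).
  - apply prv_hyp. apply I. left. reflexivity.
  - apply prv_weaken with (1 := D). intros x Hx. apply I. right. exact Hx.
Qed.

Lemma holds_lft m n (p : fm Internal (hctx m)) : m <= n ->
  holds p <-> holds (fsub (lft m n) p).
Proof.
  intro A. split.
  - intros [k [B I]]. exists (n + k). split; [lia|].
    rewrite fsub_lft by lia. rewrite <- (@fsub_lft m k (n + k)) by lia.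
    apply theory_le; [lia|auto].
  - intros [k [B I]]. exists k. split; [lia|]. rewrite <- (@fsub_lft m n k) by lia. exact I.
Qed.

Lemma holds_Bot m : ~ holds (@Bot _ (hctx m)).
Proof. intros [n [_ I]]. apply (@theory_consistent n). apply prv_hyp, I. Qed.

Lemma holds_Imp m (p q : fm Internal (hctx m)) : holds (Imp p q) <-> (holds p -> holds q).
Proof.
  split.
  - intros A B. apply holds_prv with [Imp p q; p].
    + apply prv_impE with p; apply prv_hyp; simpl; auto.
    + intros x [<-|[<-|[]]]; auto.
  - intro A. destruct (holds_dec m p) as [B|B].
    + apply holds_prv with [q]; [|intros x [<-|[]]; auto].
      apply prv_impI, prv_hyp. simpl. auto.
    + apply holds_prv with [Not p]; [|intros x [<-|[]]; auto].
      apply prv_impI, prv_exfalso. apply prv_impE with p; apply prv_hyp; simpl; auto.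
Qed.

(** The converse direction takes for the term the witness of the Henkin axiom. *)
Lemma holds_All m s (p : fm Internal (s :: hctx m)) : holds (All s p) <->
  forall n (t : tm (hctx n) s), m <= n -> holds (fsub (scons t (lft m n)) p).
Proof.
  split.
  - intros A n t B. apply (@holds_lft m n) in A; [|exact B].
    apply holds_prv with [fsub (lft m n) (All s p)]; [|intros x [<-|[]]; auto].
    replace (fsub (scons t (lft m n)) p) with (inst (fsub (slift (lft m n)) p) t).
    + apply prv_allE, prv_hyp. simpl. auto.
    + unfold inst. rewrite fsub_fsub, slift_scons. f_equal. f_equal.
      apply tup_ext. intros. apply tsub_ids.
  - intro A. destruct (nth_ty_all s) as [i Hi], (nth_fm_all p) as [j Hj].
    set (n := to_nat (i, to_nat (m, j))).
    assert (B : m <= n).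
    { pose proof (to_nat_non_decreasing m j).
      pose proof (to_nat_non_decreasing i (to_nat (m, j))). unfold n. lia. }
    assert (E : tau n = s) by (unfold tau, n; rewrite cancel_of_to; exact Hi).
    clear Hi. subst s.
    assert (W : witnessed n = fsub (slift (lft m n)) p).
    { unfold witnessed. replace (of_nat (snd (of_nat n))) with (m, j).
      - rewrite Hj. reflexivity.
      - unfold n. rewrite cancel_of_to. cbn [snd]. rewrite cancel_of_to. reflexivity. }
    apply holds_lft with (n := S n); [lia|].
    assert (I : @holds (S n) (henkin n)).
    { exists (S n). split; [lia|]. rewrite lft_refl, fsub_ids. left. reflexivity. }
    apply holds_Imp with (p := witnessed n) in I.
    + rewrite W in I. rewrite lft_S by lia. unfold fwk in I. simpl in I. simpl.
      rewrite fsub_fsub, slift_comp in I. exact I.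
    + rewrite W. specialize (A (S n) (Var vz)). rewrite lft_S in A by lia. apply A. lia.
Qed.

Lemma holds_ax m (p : fm Internal (hctx m)) : EPA_ax p -> holds p.
Proof. intro A. apply holds_prv with []; [apply prv_ax, A | intros q []]. Qed.

Lemma holds_eqt_arr m r s (x y : tm (hctx m) (r ~> s)) : holds (eqt x y) <->
  forall n (t : tm (hctx n) r), m <= n ->
    holds (eqt (App (tsub (lft m n) x) t) (App (tsub (lft m n) y) t)).
Proof.
  cbn [eqt]. rewrite holds_All. split; intros A n t B; specialize (A n t B);
    rewrite fsub_eqt in *; simpl in *; rewrite !tsub_wk in *; exact A.
Qed.

Lemma holds_refl s : forall m (x : tm (hctx m) s), holds (eqt x x).
Proof.
  induction s; intros m x.
  - apply holds_ax. constructor.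
  - apply holds_eqt_arr. intros. apply IHs2.
Qed.

Lemma holds_sym s : forall m (x y : tm (hctx m) s), holds (eqt x y) -> holds (eqt y x).
Proof.
  induction s; intros m x y A.
  - revert A. apply holds_Imp, holds_ax. constructor.
  - apply holds_eqt_arr. intros. apply IHs2. revert n t H. apply holds_eqt_arr, A.
Qed.

Lemma holds_trans s : forall m (x y z : tm (hctx m) s),
  holds (eqt x y) -> holds (eqt y z) -> holds (eqt x z).
Proof.
  induction s; intros m x y z A B.
  - revert B. apply holds_Imp. revert A. apply holds_Imp, holds_ax. constructor.
  - apply holds_eqt_arr. intros n t H.
    apply IHs2 with (App (tsub (lft m n) y) t); revert n t H; apply holds_eqt_arr; auto.
Qed.

Lemma holds_app m r s (z z' : tm (hctx m) (r ~> s)) (x x' : tm (hctx m) r) :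
  holds (eqt z z') -> holds (eqt x x') -> holds (eqt (App z x) (App z' x')).
Proof.
  intros A B. apply holds_trans with (App z x').
  - revert B. apply holds_Imp, holds_ax. constructor.
  - pose proof (proj1 (@holds_eqt_arr m r s z z') A m x' (le_n m)) as C.
    rewrite lft_refl, !tsub_ids in C. exact C.
Qed.

(** The elements of the model are the classes of terms under provable equality in the limit.
    Taking classes makes equality in the model identity. *)
Definition elt (s : ty) := {n & tm (hctx n) s}.

Definition eqv s (x y : elt s) : Prop := exists k, projT1 x <= k /\ projT1 y <= k /\
  holds (eqt (tsub (lft (projT1 x) k) (projT2 x)) (tsub (lft (projT1 y) k) (projT2 y))).

Lemma eqv_at s (x y : elt s) : eqv x y -> forall k, projT1 x <= k -> projT1 y <= k ->
  holds (eqt (tsub (lft (projT1 x) k) (projT2 x)) (tsub (lft (projT1 y) k) (projT2 y))).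
Proof.
  intros [n [A [B H]]] k C D. apply (@holds_lft k (n + k)); [lia|].
  apply (@holds_lft n (n + k)) in H; [|lia]. rewrite fsub_eqt, !tsub_lft in * by lia. exact H.
Qed.

Definition hdom (s : ty) := {P : elt s -> Prop | exists x, P = eqv x}.

Definition den s n (t : tm (hctx n) s) : hdom s :=
  exist _ (eqv (existT (fun n => tm (hctx n) s) n t)) (ex_intro _ _ eq_refl).

Lemma den_eqv s n (t : tm (hctx n) s) m (u : tm (hctx m) s) k : n <= k -> m <= k ->
  den n t = den m u <-> holds (eqt (tsub (lft n k) t) (tsub (lft m k) u)).
Proof.
  intros A B. split.
  - intro E. apply (f_equal (@proj1_sig _ _)) in E. simpl in E.
    apply (@eqv_at s (existT _ n t) (existT _ m u)); auto.
    rewrite E. exists k. simpl. split; [|split]; auto. apply holds_refl.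
  - intro E.
    assert (F : eqv (existT (fun n => tm (hctx n) s) n t) = eqv (existT _ m u)).
    { apply functional_extensionality. intros [i v]. apply propositional_extensionality.
      assert (X : @eqv s (existT _ n t) (existT _ m u)) by (exists k; auto).
      split; intro Y; exists (k + i); (split; [simpl; lia|split; [simpl; lia|]]).
      - apply holds_trans with (tsub (lft n (k + i)) t).
        + apply holds_sym. apply (eqv_at X); simpl; lia.
        + apply (eqv_at Y); simpl; lia.
      - apply holds_trans with (tsub (lft m (k + i)) u).
        + apply (eqv_at X); simpl; lia.
        + apply (eqv_at Y); simpl; lia. }
    unfold den.
    generalize (ex_intro (fun x => eqv (existT (fun n => tm (hctx n) s) n t) = eqv x)
      _ eq_refl). rewrite F. intro e. f_equal. apply proof_irrelevance.
Qed.

Lemma den_lft s n (t : tm (hctx n) s) k : n <= k -> den n t = den k (tsub (lft n k) t).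
Proof.
  intro A. apply (den_eqv _ _ A (le_n k)). rewrite lft_refl, tsub_ids. apply holds_refl.
Qed.

Lemma den_eq s n (t u : tm (hctx n) s) : den n t = den n u <-> holds (eqt t u).
Proof. rewrite den_eqv with (k := n) by lia. rewrite lft_refl, !tsub_ids. tauto. Qed.

Lemma den_surj s (x : hdom s) : exists p : elt s, x = den (projT1 p) (projT2 p).
Proof.
  destruct x as [P [[n t] E]]. exists (existT _ n t). subst P. reflexivity.
Qed.

Definition rep s (x : hdom s) : elt s :=
  proj1_sig (constructive_indefinite_description _ (den_surj x)).

Lemma den_rep s (x : hdom s) : x = den (projT1 (rep x)) (projT2 (rep x)).
Proof. unfold rep. destruct constructive_indefinite_description. simpl. auto. Qed.

Definition happ r s (f : hdom (r ~> s)) (x : hdom r) : hdom s :=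
  let k := projT1 (rep f) + projT1 (rep x) in
  den k (App (tsub (lft _ k) (projT2 (rep f))) (tsub (lft _ k) (projT2 (rep x)))).

Lemma happ_den r s n (t : tm (hctx n) (r ~> s)) (u : tm (hctx n) r) :
  happ (den n t) (den n u) = den n (App t u).
Proof.
  unfold happ. pose proof (den_rep (den n t)) as A. pose proof (den_rep (den n u)) as B.
  destruct (rep (den n t)) as [i t']. destruct (rep (den n u)) as [j u']. simpl in *.
  apply (@den_eqv _ _ _ _ _ (n + i + j)); try lia. simpl. rewrite !tsub_lft by lia.
  apply holds_app; apply holds_sym; apply den_eqv; auto; lia.
Qed.

Definition hstr : structure := {|
  dom := hdom;
  ap := happ;
  zero := den 0 Zero;
  succ := den 0 Succ;
  kpi := fun r s => den 0 (Pi r s);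
  ksigma := fun r s q => den 0 (Sigma r s q);
  krec := fun s => den 0 (Rec s)
|}.

Definition dens G n (f : tup G (hctx n)) : env hstr G := fun s v => den n (f s v).
Arguments dens {G n} f s _.

Lemma dens_lft G n (f : tup G (hctx n)) k : n <= k ->
  dens f = dens (fun s v => tsub (lft n k) (f s v)).
Proof. intro A. apply env_ext. intros s v. apply den_lft, A. Qed.

Lemma dens_surj G (e : env hstr G) : exists n (f : tup G (hctx n)), e = dens f.
Proof.
  induction G as [|r G IH].
  - exists 0, (var_nil _). apply env_nil.
  - destruct (IH (etl e)) as [n [f Hf]]. destruct (den_surj (ehd e)) as [[m t] Ht].
    simpl in Ht.
    exists (n + m), (scons (tsub (lft m _) t) (fun s v => tsub (lft n _) (f s v))).
    rewrite <- (econs_eta e), Hf, Ht. apply env_ext. intros s v.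
    case_var v; simpl; unfold dens; simpl; apply den_lft; lia.
Qed.

Lemma evt_dens G s (t : tm G s) n (f : tup G (hctx n)) :
  evt t (dens f) = den n (tsub f t).
Proof.
  induction t; simpl.
  - reflexivity.
  - rewrite IHt1, IHt2. apply happ_den.
  - apply (@den_lft N 0 Zero n); lia.
  - apply (@den_lft _ 0 Succ n); lia.
  - apply (@den_lft _ 0 (Pi r s) n); lia.
  - apply (@den_lft _ 0 (Sigma r s q) n); lia.
  - apply (@den_lft _ 0 (Rec s) n); lia.
Qed.

Lemma evf_dens G (p : fm Internal G) : forall n (f : tup G (hctx n)),
  evf p (dens f) <-> holds (fsub f p).
Proof.
  induction p as [G|G a b|G s h t|G p IHp q IHq|G s p IHp]; intros n f; simpl.
  - split; [tauto|]. apply holds_Bot.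
  - rewrite !evt_dens. apply den_eq.
  - destruct h.
  - rewrite holds_Imp. rewrite <- (IHp n f), <- (IHq n f). tauto.
  - rewrite holds_All. split.
    + intros A m t B. specialize (A (den m t)). rewrite (@dens_lft G n f m B) in A.
      rewrite fsub_fsub, slift_scons. apply (IHp m).
      match goal with |- evf _ ?a => replace a with
        (econs (den m t : dom hstr s) (dens (fun s v => tsub (lft n m) (f s v)))) end.
      * exact A.
      * apply env_ext. intros q v. case_var v; reflexivity.
    + intros A x. destruct (den_surj x) as [[m t] ->]. simpl.
      specialize (A (n + m) (tsub (lft m _) t)).
      rewrite fsub_fsub, slift_scons in A. apply (IHp (n + m)) in A; [|lia].
      rewrite (@dens_lft G n f (n + m)) by lia.
      match type of A with evf _ ?a => replace a with (econs (den m t : dom hstr s)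
        (dens (fun s v => tsub (lft n (n + m)) (f s v)))) in A end.
      * exact A.
      * apply env_ext. intros q v. case_var v; [|reflexivity]. apply den_lft. lia.
Qed.

Lemma hstr_true G (p : fm Internal G) (e : env hstr G) : EPA_ax p -> evf p e.
Proof.
  intro A. destruct (dens_surj e) as [n [f ->]]. apply evf_dens.
  apply holds_ax, EPA_ax_fsub, A.
Qed.

Lemma hstr_ext r s (f g : dom hstr (r ~> s)) : (forall x, ap f x = ap g x) -> f = g.
Proof.
  intro A. destruct (den_surj f) as [[n t] ->], (den_surj g) as [[m u] ->]. simpl in *.
  rewrite (@den_lft _ n t (n + m)), (@den_lft _ m u (n + m)) in * by lia.
  apply den_eq, holds_eqt_arr. intros k v B. apply den_eq. rewrite <- !happ_den.
  specialize (A (den k v)).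
  rewrite (@den_lft _ _ (tsub (lft n _) t) _ B), (@den_lft _ _ (tsub (lft m _) u) _ B) in A.
  exact A.
Qed.

Definition henkin_model : model := @Build_model hstr hstr_ext hstr_true.

Lemma henkin_model_sat : exists e : env henkin_model G0, forall p, In p H0 -> evf p e.
Proof.
  exists (@dens G0 0 ids). intros p A. apply evf_dens.
  exists 0. split; [lia|]. rewrite lft_refl, !fsub_ids. exact A.
Qed.
End Henkin.

(** This theorem is what allows everything else to be proved in models, by ordinary reasoning
    about functionals, in place of derivations in arithmetic. *)
Theorem completeness G (p : fm Internal G) :
  (forall (M : model) (e : env M G), evf p e) -> EPA_proves p.
Proof.
  intro A. apply prv_raa. apply NNPP. intro C.
  destruct (@henkin_model_sat G [Not p] C) as [e He].
  specialize (He (Not p) (or_introl eq_refl)). apply He, A.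
Qed.

(** * Majorization in models *)

Definition sadd (M : structure) (x z : dom M N) : dom M N :=
  ap (ap (ap (krec M N) z) x)
      (ap (ap (ksigma M N N (N ~> N)) (ap (kpi M (N ~> N ~> N) N) (kpi M N N))) succ).
Arguments sadd {M} x z.

Fixpoint smaj (M : structure) (s : ty) : dom M s -> dom M s -> Prop :=
  match s with
  | N => fun x y => exists z, sadd x z = y
  | r ~> q => fun x y => forall v u, smaj M r u v ->
      smaj M q (ap x u) (ap y v) /\ smaj M q (ap y u) (ap y v)
  end.
Arguments smaj {M s} _ _.

Definition emaj (M : structure) W (a b : env M W) := forall s v, smaj (a s v) (b s v).
Definition mon (M : structure) W (a : env M W) := emaj a a.

Lemma evf_maj (M : structure) s : forall G (x y : tm G s) (e : env M G),
  evf (maj x y) e <-> smaj (evt x e) (evt y e).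
Proof.
  induction s; intros.
  - cbn [maj]. unfold le0. rewrite evf_Ex. simpl.
    split; intros [z A]; exists z; revert A; rewrite !evt_wk; exact (fun A => A).
  - cbn [maj smaj]. cbn zeta. split; intros A v u.
    + intro B. specialize (A v u). cbn [evf] in A.
      rewrite IHs1, evf_And, !IHs2 in A. simpl in A. rewrite !evt_wk in A. apply A, B.
    + cbn [evf]. rewrite IHs1, evf_And, !IHs2. simpl. rewrite !evt_wk. apply A.
Qed.

Lemma emaj_cons (M : structure) r W (a b : env M (r :: W)) :
  emaj a b <-> smaj (ehd a) (ehd b) /\ emaj (etl a) (etl b).
Proof.
  split.
  - intro A. split; [apply A | intros s v; apply A].
  - intros [A B] s v. case_var v; [exact A | apply B].
Qed.

Lemma evf_majs (M : structure) W : forall G (x y : tup W G) (e : env M G),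
  evf (majs x y) e <-> emaj (evs x e) (evs y e).
Proof.
  induction W; intros; cbn [majs].
  - split; [intros _; refine (var_nil _) | simpl; tauto].
  - rewrite evf_And, evf_maj, IHW, emaj_cons. reflexivity.
Qed.

Section Arithmetic.
Variable M : model.

Lemma add_0 (x : dom M N) : sadd x zero = x.
Proof. apply m_rec0. Qed.

Lemma add_S (x z : dom M N) : sadd x (ap succ z) = ap succ (sadd x z).
Proof.
  unfold sadd. rewrite m_recS, m_sigma, m_pi, m_pi. reflexivity.
Qed.

Lemma add_0l (z : dom M N) : sadd zero z = z.
Proof.
  refine (@m_ind M _ (Eq0 (plus Zero (Var vz)) (Var vz)) (enil M) _ _ z).
  - apply add_0.
  - intros n A. change (sadd zero n = n) in A. change (sadd zero (ap succ n) = ap succ n).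
    rewrite add_S, A. reflexivity.
Qed.

Lemma add_Sl (x z : dom M N) : sadd (ap succ x) z = ap succ (sadd x z).
Proof.
  refine (@m_ind M _ (Eq0 (plus (App Succ (Var (vs N vz))) (Var vz))
    (App Succ (plus (Var (vs N vz)) (Var vz)))) (econs x (enil M)) _ _ z).
  - change (sadd (ap succ x) zero = ap succ (sadd x zero)). rewrite !add_0. reflexivity.
  - intros n A. change (sadd (ap succ x) n = ap succ (sadd x n)) in A.
    change (sadd (ap succ x) (ap succ n) = ap succ (sadd x (ap succ n))).
    rewrite !add_S, A. reflexivity.
Qed.

Lemma add_comm (x z : dom M N) : sadd x z = sadd z x.
Proof.
  refine (@m_ind M _ (Eq0 (plus (Var (vs N vz)) (Var vz)) (plus (Var vz) (Var (vs N vz))))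
    (econs x (enil M)) _ _ z).
  - change (sadd x zero = sadd zero x). rewrite add_0, add_0l. reflexivity.
  - intros n A. change (sadd x n = sadd n x) in A.
    change (sadd x (ap succ n) = sadd (ap succ n) x).
    rewrite add_S, add_Sl, A. reflexivity.
Qed.

Lemma add_assoc (x y z : dom M N) : sadd x (sadd y z) = sadd (sadd x y) z.
Proof.
  refine (@m_ind M _ (Eq0 (plus (Var (vs N vz)) (plus (Var (vs N (vs N vz))) (Var vz)))
    (plus (plus (Var (vs N vz)) (Var (vs N (vs N vz)))) (Var vz)))
    (econs x (econs y (enil M))) _ _ z).
  - change (sadd x (sadd y zero) = sadd (sadd x y) zero). rewrite !add_0. reflexivity.
  - intros n A. change (sadd x (sadd y n) = sadd (sadd x y) n) in A.
    change (sadd x (sadd y (ap succ n)) = sadd (sadd x y) (ap succ n)).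
    rewrite !add_S, A. reflexivity.
Qed.

Lemma smaj_refl_N (x : dom M N) : smaj x x.
Proof. exists zero. apply add_0. Qed.

Lemma smaj_right s (x y : dom M s) : smaj x y -> smaj y y.
Proof.
  destruct s; intro A; [apply smaj_refl_N|].
  intros v u B. split; apply (A v u B).
Qed.

Lemma smaj_trans s : forall (x y z : dom M s), smaj x y -> smaj y z -> smaj x z.
Proof.
  induction s; intros x y z A B.
  - destruct A as [a <-], B as [b <-]. exists (sadd a b). rewrite add_assoc. reflexivity.
  - intros v u C. split.
    + apply IHs2 with (ap y v); [apply (A v u C)|].
      apply (B v v). apply smaj_right with u, C.
    + apply (B v u C).
Qed.

Lemma smaj_app r s (f g : dom M (r ~> s)) x y :
  smaj f g -> smaj x y -> smaj (ap f x) (ap g y).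
Proof. intros A B. apply (A y x B). Qed.
Arguments smaj_app [r s f g x y] _ _.

Lemma emaj_trans W (a b c : env M W) : emaj a b -> emaj b c -> emaj a c.
Proof. intros A B s v. apply smaj_trans with (b s v); auto. Qed.

Lemma emaj_econs r W (x y : dom M r) (a b : env M W) :
  smaj x y -> emaj a b -> emaj (econs x a) (econs y b).
Proof. intros A B. apply emaj_cons. auto. Qed.

Lemma emaj_nil (a b : env M []) : emaj a b.
Proof. exact (var_nil _). Qed.

Lemma emaj_ecat W G (a b : env M W) (c d : env M G) :
  emaj a b -> emaj c d -> emaj (ecat a c) (ecat b d).
Proof.
  revert a b. induction W; intros a' b A B; simpl; [exact B|].
  apply emaj_cons in A. destruct A. apply emaj_econs; auto.
Qed.

Lemma emaj_efst W G (a b : env M (W ++ G)) : emaj a b -> emaj (efst W a) (efst W b).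
Proof. intros A s v. apply A. Qed.

Lemma emaj_esnd W G (a b : env M (W ++ G)) : emaj a b -> emaj (esnd W a) (esnd W b).
Proof. intros A s v. apply A. Qed.

Fixpoint sapps (X : ctx) (s : ty) : dom M (arrs X s) -> env M X -> dom M s :=
  match X return dom M (arrs X s) -> env M X -> dom M s with
  | [] => fun f _ => f
  | r :: X' => fun f a => @sapps X' s (ap f (ehd a)) (etl a)
  end.
Arguments sapps {X} s f a.

Lemma evt_apps X G s (t : tm G (arrs X s)) (u : tup X G) (e : env M G) :
  evt (@apps X G s t u) e = sapps s (evt t e) (evs u e).
Proof. revert t u. induction X; intros; simpl; [reflexivity|]. rewrite IHX. reflexivity. Qed.

Lemma smaj_sapps X s : forall (f g : dom M (arrs X s)) (a b : env M X),
  smaj f g -> emaj a b -> smaj (sapps s f a) (sapps s g b).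
Proof.
  induction X; intros f g b c A B; simpl; [exact A|].
  apply emaj_cons in B. destruct B as [B C]. apply IHX; [|exact C].
  apply (smaj_app (s := arrs X s)); [exact A | exact B].
Qed.

(** Majorization of functionals of several arguments can be checked with all the arguments
    supplied at once. *)
Lemma smaj_arrs X s : forall (f g : dom M (arrs X s)),
  (forall a b : env M X, emaj a b ->
    smaj (sapps s f a) (sapps s g b) /\ smaj (sapps s g a) (sapps s g b)) -> smaj f g.
Proof.
  induction X; intros f g A.
  - apply (A (enil M) (enil M)), emaj_nil.
  - intros v u B. split; apply IHX; intros b c C.
    + split.
      * apply (A (econs u b) (econs v c)), emaj_econs; auto.
      * apply (A (econs v b) (econs v c)), emaj_econs; auto. apply smaj_right with u, B.
    + split.
      * apply (A (econs u b) (econs v c)), emaj_econs; auto.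
      * apply (A (econs v b) (econs v c)), emaj_econs; auto. apply smaj_right with u, B.
Qed.

Definition sfapp X Y (f : env M (map (arrs X) Y)) (a : env M X) : env M Y :=
  fun s v => sapps s (f _ (vmap (arrs X) v)) a.

Lemma evs_fapp X Y G (f : tup (map (arrs X) Y) G) (u : tup X G) (e : env M G) :
  evs (fapp X Y f u) e = sfapp (evs f e) (evs u e).
Proof. apply env_ext. intros s v. apply evt_apps. Qed.

Lemma emaj_sfapp X Y (f g : env M (map (arrs X) Y)) (a b : env M X) :
  emaj f g -> emaj a b -> emaj (sfapp f a) (sfapp g b).
Proof. intros A B s v. apply smaj_sapps; auto. Qed.

End Arithmetic.
Arguments smaj_right [M s x y] _.
Arguments smaj_trans [M s x y z] _ _.
Arguments emaj_trans [M W a b c] _ _ s v.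
Arguments emaj_ecat [M W G a b c d] _ _ s _.
Arguments emaj_efst [M W G a b] _ s v.
Arguments emaj_esnd [M W G a b] _ s v.
Arguments emaj_sfapp [M X Y f g a b] _ _ s v.
Arguments smaj_app [M r s f g x y] _ _.
Arguments sapps {M X} s f a.
Arguments sfapp {M X Y} f a s _.

(** * Functional abstraction *)

(** Bracket abstraction: the combinators define lambda terms. *)
Fixpoint lam r G s (t : tm (r :: G) s) : tm G (r ~> s) :=
  match t with
  | Var v => var_cons (fun s _ => tm G (r ~> s))
      (App (App (Sigma r (r ~> r) r) (Pi r (r ~> r))) (Pi r r))
      (fun s w => App (Pi s r) (Var w)) v
  | @App _ q s a b => App (App (Sigma r q s) (lam a)) (lam b)
  | Zero => App (Pi _ r) Zero
  | Succ => App (Pi _ r) Succ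
  | Pi p q => App (Pi _ r) (Pi p q)
  | Sigma p q u => App (Pi _ r) (Sigma p q u)
  | Rec q => App (Pi _ r) (Rec q)
  end.

Lemma evt_lam (M : model) r G s (t : tm (r :: G) s) (e : env M G) x :
  ap (evt (lam t) e) x = evt t (econs x e).
Proof.
  induction t; simpl.
  - revert v. revert s. refine (var_cons _ _ _); [|intros s w]; simpl.
    + rewrite m_sigma, m_pi. reflexivity.
    + apply m_pi.
  - rewrite m_sigma, IHt1, IHt2. reflexivity.
  - apply m_pi.
  - apply m_pi.
  - apply m_pi.
  - apply m_pi.
  - apply m_pi.
Qed.

Lemma abstract_block B : forall G s (t : tm (B ++ G) s), exists u : tm G (arrs B s),
  forall (M : model) (e : env M G) b, sapps s (evt u e) b = evt t (ecat b e).
Proof.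
  induction B as [|r B IH]; intros G s t.
  - exists t. reflexivity.
  - (* [lam] binds the innermost variable, but the first variable of a block must be bound last;
       [f] moves it outside the rest of the block *)
    pose (f := scons (Var (shift B vz)) (tcat (here B) (up B (fun s v => Var (vs r v))))
      : tup (r :: B ++ G) (B ++ r :: G)).
    destruct (IH (r :: G) s (tsub f t)) as [u Hu]. exists (lam u).
    intros M e b. simpl. rewrite evt_lam, Hu, evt_tsub. f_equal.
    unfold f. rewrite evs_scons, evs_tcat, evs_here, evs_up, efst_ecat, esnd_ecat.
    f_equal. change (esnd B (ecat (etl b) (econs (ehd b) e)) r vz = ehd b).
    rewrite esnd_ecat. reflexivity.
Qed.

Lemma choose_tup (h : ty -> ty) C G (P : forall s, var C s -> tm G (h s) -> Prop) :
  (forall s v, exists u, P s v u) ->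
  exists f : tup (map h C) G, forall s v, P s v (f _ (vmap h v)).
Proof.
  induction C as [|r C IH]; intro A.
  - exists (var_nil _). refine (var_nil _).
  - destruct (A r vz) as [u Hu]. destruct (IH (fun s v => P s (vs r v))) as [f Hf].
    + intros. apply A.
    + exists (scons u f). refine (var_cons _ _ _); auto.
Qed.

Lemma choose_tup_id C G (P : forall s, var C s -> tm G s -> Prop) :
  (forall s v, exists u, P s v u) -> exists f : tup C G, forall s v, P s v (f s v).
Proof.
  intro A. induction C as [|r C IH].
  - exists (var_nil _). refine (var_nil _).
  - destruct (A r vz) as [u Hu]. destruct (IH (fun s v => P s (vs r v))) as [f Hf].
    + intros. apply A.
    + exists (scons u f). refine (var_cons _ _ _); auto.
Qed.

(** * Majorants of terms *)

(** The pointwise sum majorizes both of its monotone arguments and, unlike the pointwise maximum,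
    needs no comparison of numbers. *)
Fixpoint join (s : ty) : forall G, tm G s -> tm G s -> tm G s :=
  match s with
  | N => fun G x y => plus x y
  | r ~> q => fun G x y =>
      lam (@join q _ (App (wk r x) (Var vz)) (App (wk r y) (Var vz)))
  end.
Arguments join {s G} x y.

(** The graph of [join] in a model. *)
Fixpoint sjoin (M : structure) (s : ty) : dom M s -> dom M s -> dom M s -> Prop :=
  match s with
  | N => fun x y z => z = sadd x y
  | r ~> q => fun x y z => forall v, @sjoin M q (ap x v) (ap y v) (ap z v)
  end.
Arguments sjoin {M s} x y z.

Lemma sjoin_join (M : model) s : forall G (x y : tm G s) (e : env M G),
  sjoin (evt x e) (evt y e) (evt (join x y) e).
Proof.
  induction s; intros G x y e; simpl; [reflexivity|].
  intro v. rewrite evt_lam.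
  specialize (IHs2 _ (App (wk s1 x) (Var vz)) (App (wk s1 y) (Var vz)) (econs v e)).
  simpl in IHs2. rewrite !evt_wk in IHs2. exact IHs2.
Qed.

Section Join.
Variable M : model.

Lemma smaj_sjoin s : forall x y x' y' z z' : dom M s, smaj x x' -> smaj y y' ->
  sjoin x y z -> sjoin x' y' z' -> smaj x z' /\ smaj y z' /\ smaj z z'.
Proof.
  induction s; intros x y x' y' z z' A B C D.
  - simpl in C, D. subst z z'. destruct A as [a <-], B as [b <-]. split; [|split].
    + exists (sadd a (sadd y b)). apply add_assoc.
    + exists (sadd b (sadd x a)). rewrite add_assoc. apply add_comm.
    + exists (sadd a b). rewrite !add_assoc. f_equal.
      rewrite <- !add_assoc. f_equal. apply add_comm.
  - assert (E : forall v u, smaj u v -> smaj (ap x u) (ap z' v) /\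
      smaj (ap y u) (ap z' v) /\ smaj (ap z u) (ap z' v)).
    { intros v u U. apply IHs2 with (ap x' v) (ap y' v); auto using smaj_app. }
    assert (F : forall v u, smaj u v -> smaj (ap z' u) (ap z' v)).
    { intros v u U. apply IHs2 with (ap x' u) (ap y' u) (ap x' v) (ap y' v); auto.
      - apply (A v u U).
      - apply (B v u U). }
    split; [|split]; intros v u U; split; auto; apply (E v u U).
Qed.
End Join.
Arguments smaj_sjoin [M s x y x' y' z z'] _ _ _ _.

(** The functional [fun z p k => join p (z p k)], which turns a step functional into one that
    never decreases. *)
Definition incr (s : ty) G : tm G ((s ~> N ~> s) ~> s ~> N ~> s) :=
  lam (lam (lam (join (Var (vs _ vz))
    (App (App (Var (vs _ (vs _ vz))) (Var (vs _ vz))) (Var vz))))).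
Arguments incr s {G}.

(** The majorant of the recursor.  The recursor itself is not monotone in its numerical
    argument, so the step is made increasing. *)
Definition recj (s : ty) G : tm G (N ~> s ~> (s ~> N ~> s) ~> s) :=
  lam (lam (lam (App (App (App (Rec s) (Var (vs _ (vs _ vz)))) (Var (vs _ vz)))
    (App (incr s) (Var vz))))).
Arguments recj s {G}.

Section RecMajorant.
Variable M : model.
Variable s : ty.
Notation step := (s ~> N ~> s).
Notation rc n y z := (ap (ap (ap (krec M s) n) y) z).

Let J := evt (incr s (G := [])) (enil M).
Let R := evt (recj s (G := [])) (enil M).
Notation rj n y z := (ap (ap (ap R n) y) z).

Lemma sjoin_unique t : forall x y u v : dom M t, sjoin x y u -> sjoin x y v -> u = v.
Proof.
  induction t; simpl; intros x y u v A B; [congruence|].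
  apply mext. intro w. apply (IHt2 _ _ _ _ (A w) (B w)).
Qed.

Lemma sjoin_incr G (e : env M G) z p k :
  sjoin p (ap (ap z p) k) (ap (ap (ap (evt (incr s) e) z) p) k).
Proof.
  unfold incr. rewrite !evt_lam.
  match goal with |- sjoin _ _ (evt (join ?x ?y) ?e1) => exact (sjoin_join M x y e1) end.
Qed.

Lemma evt_incr G (e : env M G) : evt (incr s) e = J.
Proof.
  apply mext; intro z. apply mext; intro p. apply mext; intro k.
  eapply sjoin_unique; apply sjoin_incr.
Qed.

Lemma evt_recj G (e : env M G) : evt (recj s) e = R.
Proof.
  apply mext; intro n. apply mext; intro y. apply mext; intro z.
  unfold R, recj. rewrite !evt_lam. cbn [evt]. rewrite !evt_incr. reflexivity.
Qed.

Lemma rj_rec n y z : rj n y z = rc n y (ap J z).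
Proof. unfold R, recj. rewrite !evt_lam. cbn [evt]. rewrite evt_incr. reflexivity. Qed.

Lemma rj_0 y z : rj zero y z = y.
Proof. rewrite rj_rec. apply m_rec0. Qed.

Lemma rj_S n y z : sjoin (rj n y z) (ap (ap z (rj n y z)) n) (rj (ap succ n) y z).
Proof. rewrite !rj_rec, m_recS. apply sjoin_incr. Qed.

Lemma rec_smaj_rj y y' (z z' : dom M step) n : smaj y y' -> smaj z z' ->
  smaj (rc n y z) (rj n y' z') /\ smaj (rj n y z) (rj n y' z').
Proof.
  intros A B.
  (* induction in the model needs the claim as a formula p *)
  pose (e := econs y (econs y' (econs z (econs z' (enil M))))).
  pose (v1 := Var (vs N vz) : tm (N :: s :: s :: step :: step :: []) s).
  pose (v2 := Var (vs N (vs s vz)) : tm (N :: s :: s :: step :: step :: []) s).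
  pose (v3 := Var (vs N (vs s (vs s vz))) : tm (N :: s :: s :: step :: step :: []) step).
  pose (v4 := Var (vs N (vs s (vs s (vs step vz))))
    : tm (N :: s :: s :: step :: step :: []) step).
  pose (p := And
    (maj (App (App (App (Rec s) (Var vz)) v1) v3) (App (App (App (recj s) (Var vz)) v2) v4))
    (maj (App (App (App (recj s) (Var vz)) v1) v3) (App (App (App (recj s) (Var vz)) v2) v4))
    : fm Internal (N :: s :: s :: step :: step :: [])).
  assert (E : forall n, evf p (econs n e) <->
    smaj (rc n y z) (rj n y' z') /\ smaj (rj n y z) (rj n y' z')).
  { intro m. unfold p. rewrite evf_And, !evf_maj. cbn [evt]. rewrite !evt_recj. reflexivity. }
  apply E. apply m_ind.
  - apply E. rewrite m_rec0, !rj_0. auto.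
  - intros m H. apply E in H. apply E. destruct H as [H1 H2]. clear E p.
    assert (Z : forall x x', smaj x x' -> smaj (ap (ap z x) m) (ap (ap z' x') m)).
    { intros. apply (smaj_app (s := s)); [apply (smaj_app (s := N ~> s))|]; auto.
      apply smaj_refl_N. }
    rewrite m_recS. split.
    + apply smaj_trans with (ap (ap z' (rj m y' z')) m); auto.
      apply (smaj_sjoin (smaj_right H2) (smaj_right (Z _ _ H2))
        (rj_S m y' z') (rj_S m y' z')).
    + apply (smaj_sjoin H2 (Z _ _ H2) (rj_S m y z) (rj_S m y' z')).
Qed.

Lemma rj_le y (z : dom M step) n k : smaj y y -> smaj z z ->
  smaj (rj n y z) (rj (sadd n k) y z).
Proof.
  intros A B.
  pose (e := econs n (econs y (econs z (enil M)))).
  pose (v1 := Var (vs N vz) : tm (N :: N :: s :: step :: []) N).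
  pose (v2 := Var (vs N (vs N vz)) : tm (N :: N :: s :: step :: []) s).
  pose (v3 := Var (vs N (vs N (vs s vz))) : tm (N :: N :: s :: step :: []) step).
  pose (p := maj (App (App (App (recj s) v1) v2) v3)
    (App (App (App (recj s) (plus v1 (Var vz))) v2) v3)
    : fm Internal (N :: N :: s :: step :: [])).
  assert (E : forall k, evf p (econs k e) <-> smaj (rj n y z) (rj (sadd n k) y z)).
  { intro m. unfold p. rewrite !evf_maj. cbn [evt]. rewrite !evt_recj. reflexivity. }
  apply E. apply m_ind.
  - apply E. rewrite add_0. apply rec_smaj_rj; auto.
  - intros m H. apply E in H. apply E. clear E p. apply smaj_trans with (1 := H).
    rewrite add_S.
    assert (Q : smaj (rj (sadd n m) y z) (rj (sadd n m) y z)) by (eapply smaj_right, H).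
    assert (Z : smaj (ap (ap z (rj (sadd n m) y z)) (sadd n m))
      (ap (ap z (rj (sadd n m) y z)) (sadd n m))).
    { apply (smaj_app (s := s)); [apply (smaj_app (s := N ~> s))|]; auto.
      apply smaj_refl_N. }
    apply (smaj_sjoin Q Z (rj_S _ y z) (rj_S _ y z)).
Qed.

Lemma rec_smaj : smaj (krec M s) R.
Proof.
  apply (@smaj_arrs M [N; s; step] s). intros a b A.
  pose proof (A _ vz) as [k Hk]. pose proof (A _ (vs N vz)) as Hy.
  pose proof (A _ (vs N (vs s vz))) as Hz.
  assert (C : smaj (rj (a N vz) (b s (vs N vz)) (b step (vs N (vs s vz))))
    (rj (b N vz) (b s (vs N vz)) (b step (vs N (vs s vz))))).
  { rewrite <- Hk. apply rj_le; eapply smaj_right; eauto. }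
  split; (eapply smaj_trans; [|exact C]); apply rec_smaj_rj; auto.
Qed.
End RecMajorant.

Lemma succ_smaj (M : model) : smaj (M := M) (s := N ~> N) succ succ.
Proof.
  assert (A : forall u v : dom M N, smaj u v -> smaj (s := N) (ap succ u) (ap succ v)).
  { intros u v [z <-]. exists z. apply add_Sl. }
  intros v u B. split; apply A; exact B.
Qed.

Lemma pi_smaj (M : model) r s : smaj (kpi M r s) (kpi M r s).
Proof.
  apply (@smaj_arrs M [r; s] r). intros a b A. cbn [sapps]. rewrite !m_pi.
  split; apply (A _ vz).
Qed.

Lemma sigma_smaj (M : model) r s q : smaj (ksigma M r s q) (ksigma M r s q).
Proof.
  apply (@smaj_arrs M [r ~> s ~> q; r ~> s; r] q). intros a b A. cbn [sapps].
  rewrite !m_sigma.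
  pose proof (A _ vz) as X. pose proof (A _ (vs _ vz)) as Y.
  pose proof (A _ (vs _ (vs _ vz))) as Z.
  assert (C : smaj
    (ap (ap (a _ vz) (a _ (vs _ (vs _ vz)))) (ap (a _ (vs _ vz)) (a _ (vs _ (vs _ vz)))))
    (ap (ap (b _ vz) (b _ (vs _ (vs _ vz)))) (ap (b _ (vs _ vz)) (b _ (vs _ (vs _ vz)))))).
  { apply (smaj_app (s := q)); [apply (smaj_app (s := s ~> q))|]; auto.
    apply (smaj_app (s := s)); auto. }
  split; exact C.
Qed.

(** Howard's majorization theorem.  All combinators except the recursor majorize themselves. *)
Lemma majorant G s (t : tm G s) : exists t' : tm G s,
  forall (M : model) (e e' : env M G), emaj e e' ->
    smaj (evt t e) (evt t' e') /\ smaj (evt t' e) (evt t' e').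
Proof.
  assert (W : forall s (t t' : tm G s), (forall (M : model) (e e' : env M G),
      smaj (evt t e) (evt t' e')) -> (forall (M : model) (e e' : env M G), evt t' e = evt t' e')
    -> exists t' : tm G s, forall (M : model) (e e' : env M G), emaj e e' ->
      smaj (evt t e) (evt t' e') /\ smaj (evt t' e) (evt t' e')).
  { intros q u u' A B. exists u'. intros M e e' H. split; [apply A|].
    rewrite (B M e e'). eapply smaj_right, (A M e e'). }
  induction t as [s v|r s a IHa b IHb| | |r s|r s q|s].
  - exists (Var v). intros M e e' H. split; apply H.
  - destruct IHa as [a' Ha], IHb as [b' Hb]. exists (App a' b'). intros M e e' H.
    destruct (Ha M e e' H), (Hb M e e' H). split; simpl; apply (smaj_app (s := s)); auto.
  - apply (W _ Zero Zero); [intros; apply smaj_refl_N|reflexivity].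
  - apply (W _ Succ Succ); [intros; apply succ_smaj|reflexivity].
  - apply (W _ (Pi r s) (Pi r s)); [intros; apply pi_smaj|reflexivity].
  - apply (W _ (Sigma r s q) (Sigma r s q)); [intros; apply sigma_smaj|reflexivity].
  - apply (W _ (Rec s) (recj s)); intros M e e'.
    + rewrite evt_recj. apply rec_smaj.
    + transitivity (evt (recj s) (enil M)); [|symmetry]; apply evt_recj.
Qed.

(** * Definable maps *)

(** Realizers are written as functions on environments.  That one term tuple gives the function
    in all models is the uniformity that the extracted terms need. *)
Definition dfn G C (T : forall M : model, env M G -> env M C) : Prop :=
  exists t : tup C G, forall (M : model) (e : env M G), T M e = evs t e.
Arguments dfn {G C} T.

Lemma dfn_id G : dfn (fun M (e : env M G) => e).
Proof. exists ids. reflexivity. Qed.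

Lemma dfn_comp G C D (U : forall M : model, env M C -> env M D)
    (T : forall M : model, env M G -> env M C) :
  dfn U -> dfn T -> dfn (fun M e => U M (T M e)).
Proof.
  intros [u Hu] [t Ht]. exists (fun s v => tsub t (u s v)). intros M e.
  rewrite Hu, Ht. apply env_ext. intros s v. symmetry. apply evt_tsub.
Qed.

Lemma dfn_ecat G C D (T : forall M : model, env M G -> env M C)
    (U : forall M : model, env M G -> env M D) :
  dfn T -> dfn U -> dfn (fun M e => ecat (T M e) (U M e)).
Proof.
  intros [t Ht] [u Hu]. exists (tcat t u). intros M e. rewrite evs_tcat, Ht, Hu. reflexivity.
Qed.

Lemma dfn_efst G C D (T : forall M : model, env M G -> env M (C ++ D)) :
  dfn T -> dfn (fun M e => efst C (T M e)).
Proof.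
  apply dfn_comp with (U := fun M e => efst C e). exists (here C). reflexivity.
Qed.

Lemma dfn_esnd G C D (T : forall M : model, env M G -> env M (C ++ D)) :
  dfn T -> dfn (fun M e => esnd C (T M e)).
Proof.
  apply dfn_comp with (U := fun M e => esnd C e). exists (up C ids). intros M e.
  rewrite evs_up. reflexivity.
Qed.

Lemma dfn_fapp G X Y (T : forall M : model, env M G -> env M (map (arrs X) Y))
    (U : forall M : model, env M G -> env M X) :
  dfn T -> dfn U -> dfn (fun M e => sfapp (T M e) (U M e)).
Proof.
  intros [t Ht] [u Hu]. exists (fapp X Y t u). intros M e. rewrite evs_fapp, Ht, Hu. reflexivity.
Qed.

Lemma dfn_nil G : dfn (fun M (_ : env M G) => enil M).
Proof. exists (var_nil _). intros. apply env_nil. Qed.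

Definition edflt (M : model) C : env M C := fun s _ => evt (dflt [] s) (enil M).
Arguments edflt M C s _ : clear implicits.

Lemma mon_edflt (M : model) C : mon (edflt M C).
Proof.
  intros s v. unfold edflt. clear v. induction s; [apply smaj_refl_N|].
  intros v u _. simpl. rewrite !m_pi. auto.
Qed.

Lemma dfn_edflt G C : dfn (fun M (_ : env M G) => edflt M C).
Proof.
  exists (fun s _ => cl G (dflt [] s)). intros M e. apply env_ext. intros s v.
  unfold evs, cl. rewrite evt_tsub. unfold edflt. f_equal. apply env_nil.
Qed.

Ltac dfn_tac := repeat first
  [ assumption
  | apply dfn_id | apply dfn_nil | apply dfn_edflt
  | apply dfn_ecat | apply dfn_efst | apply dfn_esnd | apply dfn_fapp
  | match goal with H : dfn ?T |- dfn (fun M x => ?T M _) => apply (dfn_comp H) end ].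

Definition monotone_map G C (T : forall M : model, env M G -> env M C) :=
  forall (M : model) (e e' : env M G), emaj e e' -> emaj (T M e) (T M e').
Arguments monotone_map {G C} T.

Lemma dfn_majorant G C (T : forall M : model, env M G -> env M C) : dfn T ->
  exists T', dfn T' /\ monotone_map T' /\
    forall (M : model) (e e' : env M G), emaj e e' -> emaj (T M e) (T' M e').
Proof.
  intros [t Ht].
  destruct (@choose_tup_id C G (fun s v u => forall (M : model) (e e' : env M G),
    emaj e e' -> smaj (evt (t s v) e) (evt u e') /\ smaj (evt u e) (evt u e')))
    as [t' Ht'].
  - intros s v. apply majorant.
  - exists (fun M e => evs t' e). split; [exists t'; reflexivity|]. split.
    + intros M e e' H s v. apply (Ht' s v M e e' H).
    + intros M e e' H s v. rewrite Ht. apply (Ht' s v M e e' H).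
Qed.

(** Abstraction of a block, combined with majorization: the functional obtained need only bound
    the given map, and in return it is monotone in the parameters. *)
Lemma dfn_curry B G C (T : forall M : model, env M (B ++ G) -> env M C) : dfn T ->
  exists L : forall M : model, env M G -> env M (map (arrs B) C),
    dfn L /\ monotone_map L /\
    forall (M : model) (e : env M G) b, mon e -> mon b ->
      emaj (T M (ecat b e)) (sfapp (L M e) b).
Proof.
  intros [t Ht].
  destruct (@choose_tup (arrs B) C G (fun s v u => forall (M : model) (e : env M G) b,
    sapps s (evt u e) b = evt (t s v) (ecat b e))) as [l Hl].
  { intros s v. apply abstract_block. }
  destruct (@dfn_majorant G _ (fun M e => evs l e)) as [L [D [H E]]].
  { exists l. reflexivity. }
  exists L. repeat split; auto. intros M e b He Hb s v.
  rewrite Ht. unfold evs. rewrite <- Hl. unfold sfapp.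
  apply smaj_sapps; [|exact Hb]. apply (E M e e He).
Qed.

Lemma dfn_join G C (T U : forall M : model, env M G -> env M C) : dfn T -> dfn U ->
  exists J : forall M : model, env M G -> env M C, dfn J /\
    forall (M : model) (e : env M G), mon e ->
      emaj (T M e) (J M e) /\ emaj (U M e) (J M e).
Proof.
  intros HT HU.
  destruct (dfn_majorant HT) as [T' [[t Ht] [_ ET]]].
  destruct (dfn_majorant HU) as [U' [[u Hu] [_ EU]]].
  exists (fun M e => evs (fun s v => join (t s v) (u s v)) e). split.
  { exists (fun s v => join (t s v) (u s v)). reflexivity. }
  intros M e He.
  assert (A : forall s v, smaj (T M e s v) (evt (join (t s v) (u s v)) e) /\
    smaj (U M e s v) (evt (join (t s v) (u s v)) e)).
  { intros s v. specialize (ET M e e He s v). specialize (EU M e e He s v).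
    rewrite Ht in ET. rewrite Hu in EU. unfold evs in *.
    pose proof (sjoin_join M (t s v) (u s v) e) as J.
    pose proof (smaj_sjoin (smaj_right ET) (smaj_right EU) J J) as [X [Y _]].
    split; eapply smaj_trans; eauto. }
  split; intros s v; apply A.
Qed.

(** * Interpretations *)

(** What the functional interpretation makes of a formula with free variables [G]: the assertion
    that for all standard monotone b : [iB] there is a standard monotone c : [iC] with R(b, c).
    Keeping the interpretations as a type of their own, and the tuple of the free variables
    apart from b and c, makes substitution in a formula an equation between interpretations.
    By [iUp] only bounds for c matter, so a realizer can be replaced by a majorant. *)
Record itp (G : ctx) := {
  iB : ctx;
  iC : ctx;
  iR : forall M : model, env M G -> env M iB -> env M iC -> Prop;
  iUp : forall (M : model) (e : env M G) b c c', iR M e b c -> emaj c c' -> iR M e b c'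
}.
Arguments iR {G} i {M} e b c.
Arguments iUp {G} i {M} e b [c c'] _ _.

Lemma itp_eq G B C R R' U U' : R = R' -> @Build_itp G B C R U = @Build_itp G B C R' U'.
Proof. intro E. subst R'. f_equal. apply proof_irrelevance. Qed.

Lemma rel_ext G B C (R R' : forall M : model, env M G -> env M B -> env M C -> Prop) :
  (forall M e b c, R M e b c <-> R' M e b c) -> R = R'.
Proof.
  intro E. apply functional_extensionality_dep; intro M.
  do 3 (apply functional_extensionality; intro).
  apply propositional_extensionality, E.
Qed.

Definition i_int G (P : forall M : model, env M G -> Prop) : itp G :=
  @Build_itp G [] [] (fun M e _ _ => P M e) (fun M e b c c' A _ => A).

Definition i_bot G : itp G := i_int (fun M (_ : env M G) => False).

Definition i_st G s (t : tm G s) : itp G.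
Proof.
  refine (@Build_itp G [] [s] (fun M e _ c => smaj (evt t e) (ehd c)) _).
  intros M e b c c' A E. eapply smaj_trans; [exact A | apply E].
Defined.

(** To pass from (forall b) (exists c) R to (forall d) (exists e) S is to compute b and e from d
    and a functional f that gives c from b.  The bound b replaces an exact counterexample: the
    premise is needed for all monotone b' up to b. *)
Definition i_imp G (i j : itp G) : itp G.
Proof.
  refine (@Build_itp G (map (arrs (iB i)) (iC i) ++ iB j) (iB i ++ iC j)
    (fun M e fd be =>
      (forall b, emaj b (efst _ be) -> mon b -> iR i e b (sfapp (efst _ fd) b)) ->
      iR j e (esnd _ fd) (esnd _ be)) _).
  intros M e fd be be' A E B. eapply iUp; [|apply emaj_esnd, E].
  apply A. intros b Hb. apply B. eapply emaj_trans; [exact Hb | apply emaj_efst, E].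
Defined.

(** The variable x need not be standard, so nothing is computed from it. *)
Definition i_all G s (i : itp (s :: G)) : itp G.
Proof.
  refine (@Build_itp G (iB i) (iC i) (fun M e b c => forall x, iR i (econs x e) b c) _).
  intros M e b c c' A E x. eapply iUp; eauto.
Defined.

Definition i_sub G D (f : tup G D) (i : itp G) : itp D :=
  @Build_itp D (iB i) (iC i) (fun M e b c => iR i (evs f e) b c)
    (fun M e b c c' A E => iUp i (evs f e) b A E).

Fixpoint interp G (p : fm External G) : itp G :=
  match p in fm _ G0 return itp G0 with
  | Bot => i_bot _
  | Eq0 t u => i_int (fun M e => evt t e = evt u e)
  | St s _ t => i_st t
  | Imp p q => i_imp (interp p) (interp q)
  | All s p => i_all (interp p)
  end.

Lemma interp_fsub G (p : fm External G) : forall D (f : tup G D),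
  interp (fsub f p) = i_sub f (interp p).
Proof.
  induction p; intros D f; simpl.
  - apply itp_eq. reflexivity.
  - apply itp_eq, rel_ext. intros. rewrite !evt_tsub. tauto.
  - apply itp_eq, rel_ext. intros. rewrite !evt_tsub. tauto.
  - rewrite IHp1, IHp2. apply itp_eq. reflexivity.
  - rewrite IHp. apply itp_eq, rel_ext. simpl. intros.
    split; intros A x; specialize (A x); rewrite evs_slift in *; exact A.
Qed.

Lemma emb_itp_imp G (P Q : forall M : model, env M G -> Prop) :
  i_imp (i_int P) (i_int Q) = i_int (fun M e => P M e -> Q M e).
Proof.
  apply itp_eq, rel_ext. intros M e b c. simpl. split.
  - intros A B. apply A. intros; exact B.
  - intros A B. apply A, (B (enil M)); apply emaj_nil.
Qed.

(** No bounds are extracted from internal formulas. *)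
Lemma interp_emb G (p : fm Internal G) : interp (emb p) = i_int (fun M e => evf p e).
Proof.
  induction p as [G|G a b|G s h t|G p IHp q IHq|G s p IHp]; simpl.
  - reflexivity.
  - reflexivity.
  - destruct h.
  - rewrite IHp, IHq. apply emb_itp_imp.
  - rewrite IHp. apply itp_eq. reflexivity.
Qed.

(** * Realizability *)

Definition realized G (i : itp G) : Prop :=
  exists T : forall M : model, env M (iB i) -> env M (iC i), dfn T /\ monotone_map T /\
    forall (M : model) (e : env M G) b, mon b -> iR i e b (T M b).

(** Monotonicity comes for free: a majorant of a realizer is again one. *)
Lemma realize G (i : itp G) (T : forall M : model, env M (iB i) -> env M (iC i)) : dfn T ->
  (forall (M : model) (e : env M G) b, mon b -> iR i e b (T M b)) -> realized i.
Proof.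
  intros D H. destruct (dfn_majorant D) as [T' [D' [M' E]]]. exists T'.
  repeat split; auto. intros M e b Hb. eapply iUp; [apply H, Hb | apply E, Hb].
Qed.

(** * Soundness of classical logic *)

Definition ent G (h i : itp G) : Prop := realized (i_imp h i).

Notation arg h := (map (arrs (iB h)) (iC h)).

Lemma ent_intro G (h i : itp G)
    (Tb : forall M : model, env M (arg h ++ iB i) -> env M (iB h))
    (Te : forall M : model, env M (arg h ++ iB i) -> env M (iC i)) : dfn Tb -> dfn Te ->
  (forall (M : model) (e : env M G) x, mon x ->
    (forall b, emaj b (Tb M x) -> mon b -> iR h e b (sfapp (efst _ x) b)) ->
    iR i e (esnd _ x) (Te M x)) -> ent h i.
Proof.
  intros Db De H. apply realize with (fun M x => ecat (Tb M x) (Te M x)).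
  - dfn_tac.
  - intros M e x Hx A. simpl in *. rewrite efst_ecat in A. rewrite esnd_ecat. auto.
Qed.

(** A hypothesis with no universal part asks for nothing and supplies a bound c. *)
Lemma ent_intro0 G C R U (i : itp G)
    (Te : forall M : model, env M (C ++ iB i) -> env M (iC i)) : dfn Te ->
  (forall (M : model) (e : env M G) c b, mon c -> mon b -> R M e (enil M) c ->
    iR i e b (Te M (ecat c b))) -> ent (@Build_itp G [] C R U) i.
Proof.
  intros D H.
  apply (@ent_intro _ (@Build_itp G [] C R U) i (fun M _ => enil M)
    (fun M x => Te M (ecat (sfapp (efst _ x) (enil M)) (esnd _ x)))); simpl; try dfn_tac.
  intros M e x Hx A. apply H.
  - apply emaj_sfapp; [apply emaj_efst, Hx | apply emaj_nil].
  - apply emaj_esnd, Hx.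
  - apply A; apply emaj_nil.
Qed.

Lemma ent_elim G (h i : itp G) : ent h i ->
  exists (Tb : forall M : model, env M (arg h ++ iB i) -> env M (iB h))
         (Te : forall M : model, env M (arg h ++ iB i) -> env M (iC i)),
    dfn Tb /\ dfn Te /\ monotone_map Tb /\ monotone_map Te /\
    forall (M : model) (e : env M G) x, mon x ->
      (forall b, emaj b (Tb M x) -> mon b -> iR h e b (sfapp (efst _ x) b)) ->
      iR i e (esnd _ x) (Te M x).
Proof.
  intros [T [D [Mt H]]].
  exists (fun M x => efst _ (T M x)), (fun M x => esnd _ (T M x)).
  split; [dfn_tac|]. split; [dfn_tac|]. split; [|split].
  - intros M e e' E. apply emaj_efst, Mt, E.
  - intros M e e' E. apply emaj_esnd, Mt, E.
  - intros M e x Hx. apply (H M e x Hx).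
Qed.

(** Conjunction, in a form with simpler types than the one that the connectives yield; it
    collects the hypotheses of a derivation. *)
Definition i_tens G (h i : itp G) : itp G.
Proof.
  refine (@Build_itp G (iB h ++ iB i) (iC h ++ iC i)
    (fun M e b c => iR h e (efst _ b) (efst _ c) /\ iR i e (esnd _ b) (esnd _ c)) _).
  intros M e b c c' [A B] E. split; eapply iUp; eauto using emaj_efst, emaj_esnd.
Defined.

Lemma ent_ax G (h i : itp G) : realized i -> ent h i.
Proof.
  intros [T [D [_ H]]].
  apply ent_intro with (fun M _ => edflt M _) (fun M x => T M (esnd _ x)); try dfn_tac.
  intros M e x Hx _. apply H, emaj_esnd, Hx.
Qed.

Lemma ent_refl G (h : itp G) : ent h h.
Proof.
  apply ent_intro with (fun M x => esnd _ x) (fun M x => sfapp (efst _ x) (esnd _ x));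
    try dfn_tac.
  intros M e x Hx H. apply H; apply emaj_esnd, Hx.
Qed.

Lemma ent_fst G (h i : itp G) : ent (i_tens h i) h.
Proof.
  apply ent_intro with (fun M x => ecat (esnd (arg (i_tens h i)) x) (edflt M (iB i)))
    (fun M x => efst (iC h) (sfapp (efst (arg (i_tens h i)) x)
      (ecat (esnd (arg (i_tens h i)) x) (edflt M (iB i))))); simpl; try dfn_tac.
  intros M e x Hx H.
  assert (A : mon (ecat (esnd _ x) (edflt M (iB i)))).
  { apply emaj_ecat; [apply emaj_esnd, Hx | apply mon_edflt]. }
  destruct (H _ A A) as [B _]. rewrite efst_ecat in B. exact B.
Qed.

Lemma ent_snd G (h i : itp G) : ent (i_tens h i) i.
Proof.
  apply ent_intro with (fun M x => ecat (edflt M (iB h)) (esnd (arg (i_tens h i)) x))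
    (fun M x => esnd (iC h) (sfapp (efst (arg (i_tens h i)) x)
      (ecat (edflt M (iB h)) (esnd (arg (i_tens h i)) x)))); simpl; try dfn_tac.
  intros M e x Hx H.
  assert (A : mon (ecat (edflt M (iB h)) (esnd _ x))).
  { apply emaj_ecat; [apply mon_edflt | apply emaj_esnd, Hx]. }
  destruct (H _ A A) as [_ B]. rewrite esnd_ecat in B. exact B.
Qed.

(** A realizer of h and a realizer of i make a realizer of their conjunction: the functional
    [L] that applies the two componentwise. *)
Lemma ent_curry G (h i j : itp G) : ent (i_tens h i) j -> ent h (i_imp i j).
Proof.
  intro H. destruct (ent_elim H) as [Tb [Te [Db [De [Mb [Me A]]]]]]. simpl in *.
  destruct (@dfn_curry (iB h ++ iB i) (arg h ++ (arg i ++ iB j)) (iC h ++ iC i)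
    (fun M z => ecat (sfapp (efst (arg h) (esnd (iB h ++ iB i) z))
                            (efst (iB h) (efst (iB h ++ iB i) z)))
                     (sfapp (efst (arg i) (esnd (arg h) (esnd (iB h ++ iB i) z)))
                            (esnd (iB h) (efst (iB h ++ iB i) z)))))
    as [L [DL [ML HL]]]; [dfn_tac|].
  pose (y := fun (M : model) (x : env M (arg h ++ (arg i ++ iB j))) =>
    ecat (L M x) (esnd (arg i) (esnd (arg h) x))).
  assert (Dy : dfn y) by (unfold y; dfn_tac).
  assert (My : monotone_map y).
  { intros M e e' E. apply emaj_ecat; [apply ML, E|]. apply emaj_esnd, emaj_esnd, E. }
  apply ent_intro with (fun M x => efst (iB h) (Tb M (y M x)))
    (fun M x => ecat (esnd (iB h) (Tb M (y M x))) (Te M (y M x))); simpl; try dfn_tac.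
  intros M e x Hx B C. rewrite efst_ecat in C. rewrite esnd_ecat.
  assert (Hy : mon (y M x)) by (apply My, Hx).
  pose proof (A M e (y M x) Hy) as F. unfold y in F at 2 3 4. rewrite efst_ecat, esnd_ecat in F.
  apply F. clear F. intros b Hb Mon.
  assert (HE := HL M x b Hx Mon). rewrite esnd_ecat, efst_ecat in HE. split.
  - eapply iUp; [apply B; [apply emaj_efst, Hb | apply emaj_efst, Mon]|].
    intros s v. specialize (HE s (inblock _ v)).
    change (smaj (efst (iC h) (ecat (sfapp (efst (arg h) x) (efst (iB h) b))
      (sfapp (efst (arg i) (esnd (arg h) x)) (esnd (iB h) b))) s v)
      (efst (iC h) (sfapp (L M x) b) s v)) in HE.
    rewrite efst_ecat in HE. exact HE.
  - eapply iUp; [apply C; [apply emaj_esnd, Hb | apply emaj_esnd, Mon]|].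
    intros s v. specialize (HE s (shift _ v)).
    change (smaj (esnd (iC h) (ecat (sfapp (efst (arg h) x) (efst (iB h) b))
      (sfapp (efst (arg i) (esnd (arg h) x)) (esnd (iB h) b))) s v)
      (esnd (iC h) (sfapp (L M x) b) s v)) in HE.
    rewrite esnd_ecat in HE. exact HE.
Qed.

(** Modus ponens under a hypothesis.  The hypothesis is used once for the implication and
    once for every argument up to the bound d that the implication asks for.  The join of the
    bound for the former use and the bound for the latter at d serves all of them. *)
Lemma ent_S G (h i j : itp G) : ent h (i_imp i j) -> ent h i -> ent h j.
Proof.
  intros H1 H2. destruct (ent_elim H1) as [Tb [Te [Db [De [Mb [Me A]]]]]].
  destruct (ent_elim H2) as [Ub [Ue [Eb [Ee [Nb [Ne B]]]]]]. simpl in *.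
  destruct (@dfn_curry (iB i) (arg h ++ iB j) (iC i)
    (fun M z => Ue M (ecat (efst (arg h) (esnd (iB i) z)) (efst (iB i) z))))
    as [L [DL [ML HL]]]; [dfn_tac|].
  pose (y := fun (M : model) (x : env M (arg h ++ iB j)) =>
    ecat (efst (arg h) x) (ecat (L M x) (esnd (arg h) x))).
  assert (Dy : dfn y) by (unfold y; dfn_tac).
  assert (My : monotone_map y).
  { intros M e e' E. apply emaj_ecat; [apply emaj_efst, E|].
    apply emaj_ecat; [apply ML, E | apply emaj_esnd, E]. }
  destruct (@dfn_join _ _ (fun M x => Tb M (y M x))
    (fun M x => Ub M (ecat (efst (arg h) x) (efst (iB i) (Te M (y M x))))))
    as [J [DJ HJ]]; [dfn_tac|dfn_tac|].
  apply ent_intro with J (fun M x => esnd (iB i) (Te M (y M x))); [exact DJ|dfn_tac|].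
  intros M e x Hx C. destruct (HJ M x Hx) as [J1 J2].
  assert (Hy : mon (y M x)) by (apply My, Hx).
  pose proof (A M e (y M x) Hy) as F. unfold y in F at 2 4 5.
  rewrite efst_ecat, !esnd_ecat, efst_ecat in F. apply F; clear F.
  - intros b Hb Mon. apply C; [|exact Mon]. eapply emaj_trans; [exact Hb | exact J1].
  - intros d Hd Mon.
    assert (Hz : mon (ecat (efst (arg h) x) d)).
    { apply emaj_ecat; [apply emaj_efst, Hx | exact Mon]. }
    pose proof (B M e _ Hz) as F. rewrite efst_ecat, esnd_ecat in F.
    eapply iUp; [apply F|].
    + intros b Hb Mb'. apply C; [|exact Mb']. eapply emaj_trans; [exact Hb|].
      eapply emaj_trans; [|exact J2]. apply Nb.
      apply emaj_ecat; [apply emaj_efst, Hx | exact Hd].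
    + pose proof (HL M x d Hx Mon) as K. rewrite esnd_ecat, efst_ecat in K. exact K.
Qed.

Lemma ent_trans G (h i j : itp G) : ent h i -> ent i j -> ent h j.
Proof. intros A B. apply ent_S with i; [apply ent_ax, B | exact A]. Qed.

Notation i_not i := (i_imp i (i_bot _)).

(** A realizer of the double negation is given the constant functional with value d as an alleged
    realizer of the negation; its answer contains a functional that is correct at d. *)
Lemma ent_dne G (i : itp G) : ent (i_not (i_not i)) i.
Proof.
  pose (ni := i_not i).
  destruct (@dfn_curry (arg i ++ []) (arg (i_not ni) ++ iB i) (iB i ++ [])
    (fun M z => ecat (esnd (arg (i_not ni)) (esnd (arg i ++ []) z)) (enil M)))
    as [L [DL [ML HL]]]; [dfn_tac|].
  pose (b0 := fun (M : model) (x : env M (arg (i_not ni) ++ iB i)) =>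
    ecat (L M x) (enil M)).
  assert (D0 : dfn b0) by (unfold b0; dfn_tac).
  pose (c0 := fun (M : model) (x : env M (arg (i_not ni) ++ iB i)) =>
    efst (arg i) (efst (arg i ++ []) (sfapp (efst (arg (i_not ni)) x) (b0 M x)))).
  apply ent_intro with b0
    (fun M x => sfapp (c0 M x) (esnd (arg (i_not ni)) x)).
  - exact D0.
  - unfold c0. dfn_tac.
  - intros M e x Hx H.
    assert (Hb : mon (b0 M x)) by (apply emaj_ecat; [apply ML, Hx | apply emaj_nil]).
    specialize (H _ Hb Hb). simpl in H. apply NNPP. intro K. apply H.
    intros g Hg Mg H'. apply K.
    assert (Md : mon (esnd (arg (i_not ni)) x)) by apply emaj_esnd, Hx.
    eapply iUp; [apply H'|].
    + intros s v. unfold b0. rewrite efst_ecat.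
      pose proof (HL M x g Hx Mg) as F. specialize (F s (inblock _ v)).
      change (smaj (efst (iB i) (ecat (esnd (arg (i_not ni)) (esnd (arg i ++ []) (ecat g x)))
        (enil M)) s v) (efst (iB i) (sfapp (L M x) g) s v)) in F.
      rewrite efst_ecat, esnd_ecat in F. exact F.
    + exact Md.
    + apply emaj_sfapp; [|exact Md]. unfold c0. apply emaj_efst, Hg.
Qed.

Lemma ent_raa G (h i : itp G) : ent (i_tens h (i_not i)) (i_bot _) -> ent h i.
Proof.
  intro A. apply ent_trans with (i_not (i_not i)); [apply ent_curry, A | apply ent_dne].
Qed.

Definition i_wk s G (i : itp G) : itp (s :: G) := i_sub (fun q v => Var (vs s v)) i.

Lemma ent_allI G s (h : itp G) (i : itp (s :: G)) : ent (i_wk s h) i -> ent h (i_all i).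
Proof.
  intros [T [D [Mt H]]]. exists T. repeat split; auto.
  intros M e b Hb A x. apply (H M (econs x e) b Hb A).
Qed.

Lemma ent_allE G s (i : itp (s :: G)) (t : tm G s) : ent (i_all i) (i_sub (scons t ids) i).
Proof.
  destruct (ent_refl (i_all i)) as [T [D [Mt H]]]. exists T. repeat split; auto.
  intros M e b Hb A. simpl. rewrite evs_scons. apply (H M e b Hb A).
Qed.

Fixpoint i_hyps G (H : list (fm External G)) : itp G :=
  match H with
  | [] => i_int (fun _ _ => True)
  | p :: H => i_tens (i_hyps H) (interp p)
  end.

Lemma i_hyps_wk s G (H : list (fm External G)) :
  i_hyps (map (@fwk External s G) H) = i_wk s (i_hyps H).
Proof.
  induction H as [|p H IH]; simpl; [apply itp_eq; reflexivity|].
  rewrite IH. unfold fwk. rewrite interp_fsub. apply itp_eq. reflexivity.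
Qed.

Lemma ent_In G (H : list (fm External G)) p : In p H -> ent (i_hyps H) (interp p).
Proof.
  induction H as [|q H IH]; [intros []|]. intros [<-|A]; simpl.
  - apply ent_snd.
  - apply ent_trans with (i_hyps H); [apply ent_fst | apply IH, A].
Qed.

Lemma soundness (Ax : forall G, fm External G -> Prop)
    (AxR : forall G p, Ax G p -> realized (interp p)) G (H : list (fm External G)) p :
  prv Ax H p -> ent (i_hyps H) (interp p).
Proof.
  induction 1.
  - apply ent_ax, AxR, H0.
  - apply ent_In, H0.
  - simpl. apply ent_curry, IHprv.
  - eapply ent_S; [apply IHprv1 | apply IHprv2].
  - apply ent_raa, IHprv.
  - simpl. apply ent_allI. rewrite <- i_hyps_wk. exact IHprv.
  - unfold inst. rewrite interp_fsub. eapply ent_trans; [apply IHprv | apply ent_allE].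
Qed.

(** * Simultaneous recursion *)

(** Any two types are retracts of one type.  The pair is built pointwise in the arguments of
    its components; at type 0 it is a function on the natural numbers with the two values. *)
Lemma pairing r s : exists p (pr : tm [] (r ~> s ~> p))
    (f : tm [] (p ~> r)) (g : tm [] (p ~> s)),
  forall (M : model) x y,
    ap (evt f (enil M)) (ap (ap (evt pr (enil M)) x) y) = x /\
    ap (evt g (enil M)) (ap (ap (evt pr (enil M)) x) y) = y.
Proof.
  revert s. induction r as [|r1 _ r2 IH]; intro s.
  - induction s as [|s1 _ s2 IH].
    + exists (N ~> N).
      exists (lam (lam (lam (App (App (App (Rec N) (Var vz)) (Var (vs _ (vs _ vz))))
        (App (Pi (N ~> N) N) (App (Pi N N) (Var (vs _ vz)))))))).
      exists (lam (App (Var vz) Zero)), (lam (App (Var vz) (App Succ Zero))).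
      intros M x y. rewrite !evt_lam. cbn [evt econs var_cons]. rewrite !evt_lam.
      cbn [evt econs var_cons]. rewrite m_rec0, m_recS, !m_pi. split; reflexivity.
    + destruct IH as [p [pr [f [g H]]]].
      exists (s1 ~> p).
      exists (lam (lam (lam (App (App (cl _ pr) (Var (vs _ (vs _ vz))))
        (App (Var (vs _ vz)) (Var vz)))))).
      exists (lam (App (cl _ f) (App (Var vz) (cl _ (dflt [] s1))))).
      exists (lam (lam (App (cl _ g) (App (Var (vs _ vz)) (Var vz))))).
      intros M x y. split; [|apply mext; intro a]; rewrite !evt_lam; cbn [evt econs var_cons];
        rewrite !evt_lam; cbn [evt econs var_cons]; rewrite !evt_cl; apply H.
  - destruct (IH s) as [p [pr [f [g H]]]].
    exists (r1 ~> p).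
    exists (lam (lam (lam (App (App (cl _ pr) (App (Var (vs _ (vs _ vz))) (Var vz)))
        (Var (vs _ vz)))))).
    exists (lam (lam (App (cl _ f) (App (Var (vs _ vz)) (Var vz))))).
    exists (lam (App (cl _ g) (App (Var vz) (cl _ (dflt [] r1))))).
    intros M x y. split; [apply mext; intro a|]; rewrite !evt_lam; cbn [evt econs var_cons];
      rewrite !evt_lam; cbn [evt econs var_cons]; rewrite !evt_cl; apply H.
Qed.

Lemma tuple_code W : exists c (enc : tm W c) (dec : tup W [c]),
  forall (M : model) (w : env M W), evs dec (econs (evt enc w) (enil M)) = w.
Proof.
  induction W as [|r W [c [enc [dec H]]]].
  - exists N, Zero, (var_nil _). intros. apply env_nil.
  - destruct (pairing r c) as [p [pr [f [g K]]]].
    exists p, (App (App (cl _ pr) (Var vz)) (wk r enc)).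
    exists (scons (App (cl _ f) (Var vz))
      (fun s v => tsub (scons (App (cl _ g) (Var vz)) (var_nil _)) (dec s v))).
    intros M w. rewrite evs_scons. cbn [evt econs var_cons].
    rewrite !evt_cl, evt_wk. destruct (K M (w r vz) (evt enc (etl w))) as [K1 K2].
    rewrite K1. refine (eq_trans _ (econs_eta w)). apply (f_equal (econs (ehd w))).
    refine (eq_trans _ (H M (etl w))). apply env_ext. intros s v. unfold evs.
    rewrite evt_tsub, evs_scons. cbn [evt econs var_cons]. rewrite evt_cl, K2.
    f_equal. f_equal. apply env_nil.
Qed.

(** The recursor has one type, so the recursion runs on a code of the tuple.  Codes need not
    respect majorization, since only the decoded values are ever compared. *)
Lemma simultaneous_rec P W (z0 : forall M : model, env M P -> env M W)
    (zs : forall M : model, env M (W ++ P) -> env M W) : dfn z0 -> dfn zs ->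
  exists R : forall M : model, env M (N :: P) -> env M W, dfn R /\
    forall (M : model) (p : env M P),
      R M (econs zero p) = z0 M p /\
      forall k, R M (econs (ap succ k) p) = zs M (ecat (R M (econs k p)) p).
Proof.
  intros [t0 H0] [ts Hs]. destruct (tuple_code W) as [c [enc [dec H]]].
  pose (X := tsub (fun s v => tsub (tcat
      (fun q w => tsub (scons (Var (vs N vz)) (var_nil _)) (dec q w))
      (fun q w => Var (vs N (vs c (vs N w))))) (ts s v)) enc : tm (N :: c :: N :: P) c).
  pose (r := App (App (App (Rec c) (Var vz)) (wk N (tsub t0 enc))) (lam (lam X))).
  assert (HX : forall (M : model) (p : env M P) n x k,
    ap (ap (evt (lam (lam X)) (econs n p)) x) k =
    evt enc (zs M (ecat (evs dec (econs x (enil M))) p))).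
  { intros. rewrite !evt_lam. unfold X. rewrite evt_tsub, Hs. f_equal.
    apply env_ext. intros s v. unfold evs at 1. rewrite evt_tsub. unfold evs at 2. f_equal.
    rewrite evs_tcat. f_equal. apply env_ext. intros q w. unfold evs. rewrite evt_tsub.
    f_equal. rewrite evs_scons. f_equal. apply env_nil. }
  assert (HY : forall (M : model) (p : env M P) n n',
    evt (lam (lam X)) (econs n p) = evt (lam (lam X)) (econs n' p)).
  { intros. apply mext. intro x. apply mext. intro k. rewrite !HX. reflexivity. }
  assert (E0 : forall (M : model) (p : env M P), evt r (econs zero p) = evt enc (z0 M p)).
  { intros. unfold r. cbn [evt econs var_cons]. rewrite m_rec0, evt_wk, evt_tsub, H0.
    reflexivity. }
  assert (ES : forall (M : model) (p : env M P) k, evt r (econs (ap succ k) p) =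
    evt enc (zs M (ecat (evs dec (econs (evt r (econs k p)) (enil M))) p))).
  { intros. unfold r at 1. cbn [evt econs var_cons]. rewrite m_recS.
    rewrite (HY M p (ap succ k) k), HX. unfold r. cbn [evt econs var_cons].
    rewrite !evt_wk, !etl_econs. reflexivity. }
  exists (fun M e => evs dec (econs (evt r e) (enil M))). split.
  - exists (fun s v => tsub (scons r (var_nil _)) (dec s v)). intros M e.
    apply env_ext. intros s v. unfold evs. rewrite evt_tsub, evs_scons.
    f_equal. f_equal. apply env_nil.
  - intros M p. rewrite E0, H. split; [reflexivity|]. intro k. rewrite ES, H. reflexivity.
Qed.

(** * Definability of matrices *)

(** Only formulas can be proved by induction in a model; the matrices are shown to be formulas
    for the sake of external induction. *)
Definition definable G (Q : forall M : model, env M G -> Prop) : Prop :=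
  exists p : fm Internal G, forall (M : model) (e : env M G), Q M e <-> evf p e.
Arguments definable {G} Q.

Lemma definable_imp G (Q R : forall M : model, env M G -> Prop) :
  definable Q -> definable R -> definable (fun M e => Q M e -> R M e).
Proof. intros [p Hp] [q Hq]. exists (Imp p q). intros M e. simpl. rewrite Hp, Hq. tauto. Qed.

Lemma definable_and G (Q R : forall M : model, env M G -> Prop) :
  definable Q -> definable R -> definable (fun M e => Q M e /\ R M e).
Proof. intros [p Hp] [q Hq]. exists (And p q). intros M e. rewrite evf_And, Hp, Hq. tauto. Qed.

Lemma definable_forall G W (Q : forall M : model, env M W -> env M G -> Prop) :
  definable (fun M (z : env M (W ++ G)) => Q M (efst W z) (esnd W z)) ->
  definable (fun M e => forall w, Q M w e).
Proof.
  intros [p Hp]. exists (Alls W p). intros M e. rewrite evf_Alls.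
  split; intros A w.
  - apply Hp. rewrite efst_ecat, esnd_ecat. apply A.
  - specialize (A w). apply Hp in A. rewrite efst_ecat, esnd_ecat in A. exact A.
Qed.

Lemma definable_comp G D (Q : forall M : model, env M G -> Prop)
    (T : forall M : model, env M D -> env M G) :
  definable Q -> dfn T -> definable (fun M e => Q M (T M e)).
Proof.
  intros [p Hp] [t Ht]. exists (fsub t p). intros M e. rewrite evf_fsub, <- Ht. apply Hp.
Qed.

Lemma definable_emaj G W (T U : forall M : model, env M G -> env M W) :
  dfn T -> dfn U -> definable (fun M e => emaj (T M e) (U M e)).
Proof.
  intros [t Ht] [u Hu]. exists (majs t u). intros M e. rewrite evf_majs, Ht, Hu. tauto.
Qed.

Definition i_def G (i : itp G) : Prop :=
  definable (fun M (z : env M (iC i ++ iB i ++ G)) =>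
    iR i (esnd _ (esnd _ z)) (efst _ (esnd _ z)) (efst _ z)).

Lemma definable_iR G D (i : itp G) (E : forall M : model, env M D -> env M G)
    (B : forall M : model, env M D -> env M (iB i))
    (C : forall M : model, env M D -> env M (iC i)) :
  i_def i -> dfn E -> dfn B -> dfn C -> definable (fun M z => iR i (E M z) (B M z) (C M z)).
Proof.
  intros A HE HB HC.
  destruct (definable_comp A (dfn_ecat HC (dfn_ecat HB HE))) as [p Hp].
  exists p. intros M e. rewrite <- Hp, !esnd_ecat, !efst_ecat. tauto.
Qed.

Lemma def_int G (p : fm Internal G) : i_def (i_int (fun M e => evf p e)).
Proof. exists p. intros M e. exact (iff_refl (evf p e)). Qed.

Lemma def_st G s (t : tm G s) : i_def (i_st t).
Proof.
  exists (maj (wk s t) (Var vz)).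
  change (forall (M : model) (z : env M (s :: G)), smaj (evt t (etl z)) (ehd z) <->
    evf (maj (wk s t) (Var vz)) z).
  intros M e. rewrite evf_maj, evt_wk. reflexivity.
Qed.

Lemma def_sub G D (f : tup G D) (i : itp G) : i_def i -> i_def (i_sub f i).
Proof.
  intro A. unfold i_def. simpl.
  apply (@definable_iR G _ i (fun M z => evs f (esnd (iB i) (esnd (iC i) z)))); auto;
    try dfn_tac.
  apply (@dfn_comp _ _ _ (fun M e => evs f e)); [exists f; reflexivity | dfn_tac].
Qed.

Lemma def_all G s (i : itp (s :: G)) : i_def i -> i_def (i_all i).
Proof.
  intro A.
  destruct (@definable_iR _ (s :: iC i ++ iB i ++ G) i
    (fun M y => econs (ehd y) (esnd (iB i) (esnd (iC i) (etl y))))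
    (fun M y => efst (iB i) (esnd (iC i) (etl y))) (fun M y => efst (iC i) (etl y)) A)
    as [p Hp].
  - exists (scons (Var vz) (fun q v => Var (vs s (shift (iC i) (shift (iB i) v))))).
    intros M e. rewrite evs_scons. reflexivity.
  - exists (fun q v => Var (vs s (shift (iC i) (inblock G v)))). reflexivity.
  - exists (fun q v => Var (vs s (inblock (iB i ++ G) v))). reflexivity.
  - exists (All s p). intros M e. split; intros B x; apply (Hp M (econs x e)), (B x).
Qed.

Lemma def_tens G (i j : itp G) : i_def i -> i_def j -> i_def (i_tens i j).
Proof. intros A B. apply definable_and; apply definable_iR; auto; dfn_tac. Qed.

Lemma def_imp G (i j : itp G) : i_def i -> i_def j -> i_def (i_imp i j).
Proof.
  intros A B. apply definable_imp; [|apply definable_iR; auto; dfn_tac].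
  apply (@definable_forall _ (iB i)
    (fun M b z => emaj b (efst (iB i) (efst (iB i ++ iC j) z)) ->
      mon b -> iR i (esnd (arg i ++ iB j) (esnd (iB i ++ iC j) z)) b
        (sfapp (efst (arg i) (efst (arg i ++ iB j) (esnd (iB i ++ iC j) z))) b))).
  apply definable_imp; [apply definable_emaj; dfn_tac|].
  apply definable_imp; [apply definable_emaj; dfn_tac|].
  apply definable_iR; auto; dfn_tac.
Qed.

Lemma def_interp G (p : fm External G) : i_def (interp p).
Proof.
  induction p as [G|G a b|G s h t|G p IHp q IHq|G s p IHp]; simpl.
  - apply (def_int Bot).
  - apply (def_int (Eq0 a b)).
  - apply def_st.
  - apply def_imp; assumption.
  - apply def_all, IHp.
Qed.

(** * Induction *)

Definition succ_sub G : tup (N :: G) (N :: G) :=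
  scons (App Succ (Var vz)) (fun s v => Var (vs N v)).

(** The induction rule.  A standard number n is given by a bound m only.  Recursion on k gives
    functionals f_k, depending on m, such that f_k realizes i(k) for all k <= m, as induction in
    the model shows.  A majorant of k |-> f_k, taken at m, bounds f_n. *)
Lemma ent_induction G (i : itp (N :: G)) : i_def i ->
  realized (i_sub (scons Zero ids) i) ->
  ent (i_st (Var vz)) (i_imp i (i_sub (@succ_sub G) i)) ->
  ent (i_st (Var vz)) i.
Proof.
  intros Def [T0 [D0 [M0 H0]]] HS.
  destruct (ent_elim HS) as [Tb [Te [Db [De [Mb [Me A]]]]]].
  cbn [iB iC iR i_st i_imp i_sub] in *.
  destruct (@dfn_curry (iB i) [N] (iC i) (fun M z => T0 M (efst (iB i) z)))
    as [L0 [DL0 [ML0 HL0]]]; [dfn_tac|].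
  destruct (@dfn_curry (iB i) (arg i ++ [N]) (iC i) (fun M z => esnd (iB i) (Te M
    (ecat (esnd (arg i) (esnd (iB i) z))
      (ecat (efst (arg i) (esnd (iB i) z)) (efst (iB i) z))))))
    as [L1 [DL1 [ML1 HL1]]].
  { apply dfn_esnd. apply (dfn_comp De). apply (@dfn_ecat _ [N]); dfn_tac. }
  destruct (simultaneous_rec DL0 DL1) as [R [DR HR]].
  destruct (dfn_majorant DR) as [R' [DR' [MR' HR']]].
  pose (K := fun (M : model) (z : env M (N :: N :: G)) =>
    econs (ehd z) (econs (ehd (etl z)) (enil M)) : env M [N; N]).
  pose (E := fun (M : model) (z : env M (N :: N :: G)) => econs (ehd z) (etl (etl z))).
  assert (DK : dfn K).
  { exists (scons (Var vz) (scons (Var (vs N vz)) (var_nil _))). intros M z.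
    rewrite !evs_scons. unfold K. do 2 apply f_equal. apply env_nil. }
  assert (DE : dfn E).
  { exists (scons (Var vz) (fun q v => Var (vs N (vs N v)))). intros M z.
    rewrite evs_scons. reflexivity. }
  assert (Dq : definable (fun M z => mon (R M (K M z)) /\
    (smaj (ehd z) (ehd (etl z)) -> forall b, mon b ->
      iR i (E M z) b (sfapp (R M (K M z)) b)))).
  { apply definable_and; [apply definable_emaj; dfn_tac|]. apply definable_imp.
    - exists (maj (Var vz) (Var (vs N vz))). intros M z. rewrite evf_maj. reflexivity.
    - apply (@definable_forall _ (iB i)
        (fun M b z => mon b -> iR i (E M z) b (sfapp (R M (K M z)) b))).
      apply definable_imp; [apply definable_emaj; dfn_tac|].
      apply definable_iR; auto; dfn_tac. }
  destruct Dq as [q Hq].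
  assert (H : forall (M : model) (e : env M G) (m k : dom M N),
    evf q (econs k (econs m e))).
  { intros M e m. pose (p := econs m (enil M) : env M [N]).
    assert (Mp : mon p) by (apply emaj_econs; [apply smaj_refl_N | apply emaj_nil]).
    destruct (HR M p) as [R0 RS].
    apply m_ind.
    - apply Hq. unfold K, E. cbn [ehd etl econs var_cons].
      change (mon (R M (econs zero p)) /\ (smaj (s := N) zero m -> forall b, mon b ->
        iR i (econs zero e) b (sfapp (R M (econs zero p)) b))).
      rewrite R0. split; [apply ML0, Mp|]. intros _ b Hb.
      eapply iUp; [|apply HL0; auto]. rewrite efst_ecat.
      specialize (H0 M e b Hb). rewrite evs_scons in H0. exact H0.
    - intros k IH. apply Hq in IH. apply Hq.
      change (mon (R M (econs k p)) /\ (smaj (s := N) k m -> forall b, mon b ->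
        iR i (econs k e) b (sfapp (R M (econs k p)) b))) in IH.
      change (mon (R M (econs (ap succ k) p)) /\ (smaj (s := N) (ap succ k) m ->
        forall b, mon b ->
          iR i (econs (ap succ k) e) b (sfapp (R M (econs (ap succ k) p)) b))).
      rewrite RS. destruct IH as [I1 I2].
      assert (Mw : mon (ecat (R M (econs k p)) p)) by (apply emaj_ecat; auto).
      split; [apply ML1, Mw|]. intros L d Hd.
      assert (L' : smaj (s := N) k m).
      { apply smaj_trans with (ap succ k); [|exact L]. exists (ap succ zero).
        rewrite add_S, add_0. reflexivity. }
      eapply iUp; [|apply HL1; auto]. rewrite !esnd_ecat, !efst_ecat.
      assert (Mx : mon (ecat p (ecat (R M (econs k p)) d))).
      { apply emaj_ecat; [exact Mp|]. apply emaj_ecat; auto. }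
      pose proof (A M (econs k e) _ Mx) as F.
      rewrite !efst_ecat, !esnd_ecat, !efst_ecat in F.
      unfold succ_sub in F. rewrite evs_scons in F. apply F.
      + intros b _ _. exact L'.
      + intros b _ Hb. apply I2; auto. }
  apply (@ent_intro0 (N :: G) [N] _ _ i (fun M z =>
    sfapp (R' M (ecat (efst [N] z) (efst [N] z))) (esnd [N] z))).
  - apply dfn_fapp; [|dfn_tac]. apply (dfn_comp DR'). apply (@dfn_ecat _ [N] [N]); dfn_tac.
  - intros M e c b Mc Mb' L. rewrite efst_ecat, esnd_ecat.
    specialize (H M (etl e) (ehd c) (ehd e)). apply Hq in H.
    change (mon (R M (econs (ehd e) (econs (ehd c) (enil M)))) /\
      (smaj (s := N) (ehd e) (ehd c) -> forall b, mon b -> iR i (econs (ehd e) (etl e)) b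
        (sfapp (R M (econs (ehd e) (econs (ehd c) (enil M)))) b))) in H.
    destruct H as [_ H]. specialize (H L b Mb'). rewrite econs_eta in H.
    eapply iUp; [exact H|]. apply emaj_sfapp; [|exact Mb']. apply HR'.
    apply emaj_econs; [exact L|]. apply emaj_cons. split; [apply smaj_refl_N | apply emaj_nil].
Qed.

(** * Logic of interpretations *)

Notation i_and i j := (i_not (i_imp i (i_not j))).

Lemma ent_mp G (h i j : itp G) : ent h i -> ent h (i_imp i j) -> ent h j.
Proof. intros A B. apply ent_S with i; assumption. Qed.

Lemma ent_fst_trans G (h i j : itp G) : ent h j -> ent (i_tens h i) j.
Proof. intro A. apply ent_trans with h; [apply ent_fst | exact A]. Qed.

Lemma ent_imp_mono G (i i' j j' : itp G) : ent i' i -> ent j j' ->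
  ent (i_imp i j) (i_imp i' j').
Proof.
  intros A B. apply ent_curry. apply ent_trans with j; [|exact B].
  apply ent_mp with i; [|apply ent_fst].
  apply ent_trans with i'; [apply ent_snd | exact A].
Qed.

Lemma ent_not_mono G (i i' : itp G) : ent i' i -> ent (i_not i) (i_not i').
Proof. intro A. apply ent_imp_mono; [exact A | apply ent_refl]. Qed.

Lemma ent_and_intro G (h i j : itp G) : ent h i -> ent h j -> ent h (i_and i j).
Proof.
  intros A B. apply ent_curry. apply ent_mp with j; [apply ent_fst_trans, B|].
  apply ent_mp with i; [apply ent_fst_trans, A | apply ent_snd].
Qed.

Lemma ent_and_elim G (i j k : itp G) : ent i (i_imp j k) -> ent (i_and i j) k.
Proof.
  intro A. apply ent_raa.
  apply ent_mp with (i_imp i (i_not j)); [|apply ent_fst].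
  apply ent_curry, ent_curry.
  apply ent_mp with k; [|apply ent_fst_trans, ent_fst_trans, ent_snd].
  apply ent_mp with j; [apply ent_snd|]. apply ent_trans with i; [|exact A].
  apply ent_fst_trans, ent_snd.
Qed.

Definition i_alls W G (i : itp (W ++ G)) : itp G :=
  @Build_itp G (iB i) (iC i) (fun M e b c => forall w, iR i (ecat w e) b c)
    (fun M e b c c' A E w => iUp i (ecat w e) b (A w) E).
Arguments i_alls W {G} i.

Lemma i_alls_nil G (i : itp G) : i_alls [] i = i.
Proof.
  destruct i as [B C R U]. apply itp_eq, rel_ext. intros M e b c.
  split; [intro A; exact (A (enil M)) | intros A w; exact A].
Qed.

Lemma i_alls_cons r W G (i : itp (r :: W ++ G)) :
  i_alls (r :: W) (i : itp ((r :: W) ++ G)) = i_alls W (i_all i).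
Proof.
  apply itp_eq, rel_ext. intros M e b c. split; intro A.
  - intros w x. apply (A (econs x w)).
  - intro w. apply (A (etl w) (ehd w)).
Qed.

Lemma interp_Alls W G (p : fm External (W ++ G)) : interp (Alls W p) = i_alls W (interp p).
Proof.
  revert p. induction W as [|r W IH]; intro p; simpl.
  - symmetry. apply i_alls_nil.
  - rewrite IH. symmetry. apply (@i_alls_cons r W G (interp p)).
Qed.

Lemma ent_alls W G (i j : itp (W ++ G)) : ent i j -> ent (i_alls W i) (i_alls W j).
Proof.
  intros [T [D [Mt H]]]. exists T. repeat split; auto. intros M e b Hb A w.
  apply (H M (ecat w e) b Hb). intros d Hd Md. apply (A d Hd Md).
Qed.

Lemma ent_all G s (i j : itp (s :: G)) : ent i j -> ent (i_all i) (i_all j).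
Proof.
  intros [T [D [Mt H]]]. exists T. repeat split; auto. intros M e b Hb A x.
  apply (H M (econs x e) b Hb). intros d Hd Md. apply (A d Hd Md).
Qed.

Definition i_wks W G (i : itp G) : itp (W ++ G) := i_sub (fun s v => Var (shift W v)) i.

Lemma ent_ex_elim G s (p : itp (s :: G)) (k : itp G) : ent p (i_wk s k) ->
  ent (i_not (i_all (i_not p))) k.
Proof.
  intro A. apply ent_raa. apply ent_mp with (i_all (i_not p)); [|apply ent_fst].
  apply ent_trans with (i_not k); [apply ent_snd|]. apply ent_allI.
  replace (i_wk s (i_not k)) with (i_not (i_wk s k)) by (apply itp_eq; reflexivity).
  apply ent_not_mono, A.
Qed.

Lemma ent_exs_elim W G (p : fm External (W ++ G)) (k : itp G) :
  ent (interp p) (i_wks W k) -> ent (interp (Exs W p)) k.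
Proof.
  revert p. induction W as [|r W IH]; intros p A; simpl.
  - replace k with (i_wks [] k); [exact A|]. destruct k. apply itp_eq. reflexivity.
  - apply IH. apply ent_ex_elim.
    replace (i_wk r (i_wks W k)) with (i_wks (r :: W) k); [exact A|].
    apply itp_eq. reflexivity.
Qed.

(** Existential quantifiers are introduced by refuting (forall w) not p, because the witness
    exists in each model but need not be the value of a term. *)
Lemma ent_exs_intro W G (p : fm External (W ++ G)) (h : itp G) :
  ent h (i_not (i_alls W (i_not (interp p)))) -> ent h (interp (Exs W p)).
Proof.
  assert (A : ent (i_not (interp (Exs W p))) (i_alls W (i_not (interp p)))).
  { clear h. revert p. induction W as [|r W IH]; intro p; simpl.
    - rewrite i_alls_nil. apply ent_refl.
    - eapply ent_trans; [apply (IH (Ex r p))|].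
      change (ent
        (i_alls W (i_not (i_not (i_all (i_not (interp (p : fm External (r :: W ++ G))))))))
        (i_alls (r :: W) (i_not (interp (p : fm External (r :: W ++ G)))))).
      rewrite i_alls_cons. apply ent_alls. exact (ent_dne _). }
  intro B. apply ent_raa. apply ent_mp with (i_alls W (i_not (interp p))).
  - eapply ent_trans; [apply ent_snd | exact A].
  - apply ent_fst_trans, B.
Qed.

(** * Standard tuples *)

(** Standardness of a tuple in the simplest form.  The condition g allows for quantifiers over
    all standard tuples and over the monotone ones. *)
Definition i_bd W G (g : forall M : model, env M W -> Prop) (x : tup W G) : itp G :=
  @Build_itp G [] W (fun M e _ c => g M (evs x e) /\ emaj (evs x e) c)
    (fun M e b c c' A E => conj (proj1 A) (emaj_trans (proj2 A) E)).

Definition g_true W (M : model) (_ : env M W) := True.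
Definition g_mon W (M : model) (w : env M W) := mon w.

Lemma sts_bd W G (x : tup W G) : ent (interp (sts x)) (i_bd (@g_true W) x).
Proof.
  induction W as [|r W IH]; cbn [sts].
  - apply ent_ax. apply realize with (fun (M : model) _ => enil M); [dfn_tac|].
    intros M e b Hb. split; [exact I | apply emaj_nil].
  - apply ent_and_elim.
    apply ent_trans with (i_imp (i_bd (@g_true W) (ttail x)) (i_bd (@g_true (r :: W)) x)).
    + apply ent_curry.
      apply (@ent_intro0 G (r :: W) _ _ (i_bd (@g_true (r :: W)) x) (fun M z => efst (r :: W) z));
        [dfn_tac|].
      intros M e c b Mc Mb [A [_ B]]. rewrite efst_ecat. split; [exact I|].
      apply emaj_cons. split; [exact A | exact B].
    + apply ent_imp_mono; [apply IH | apply ent_refl].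
Qed.

Lemma bd_sts W G (x : tup W G) : ent (i_bd (@g_true W) x) (interp (sts x)).
Proof.
  induction W as [|r W IH]; cbn [sts].
  - apply ent_ax, ent_refl.
  - apply ent_and_intro.
    + apply (@ent_intro0 G (r :: W) _ _ (i_st (thead x)) (fun M z => econs (ehd z) (enil M))).
      * exists (scons (Var vz) (var_nil _)). intros M e.
        refine (eq_trans _ (eq_sym (evs_scons _ _ _))).
        apply (f_equal (econs (ehd e))), env_nil.
      * intros M e c b Mc Mb [_ A]. apply (A r vz).
    + apply ent_trans with (i_bd (@g_true W) (ttail x)); [|apply IH].
      apply (@ent_intro0 G (r :: W) _ _ (i_bd (@g_true W) (ttail x)) (fun M z => efst W (etl z))).
      * exists (fun s v => Var (vs r (inblock [] v))). reflexivity.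
      * intros M e c b Mc Mb [_ A]. split; [exact I|]. intros s v.
        change (smaj (evs x e (vs r v)) (efst W (ecat (etl c) b) s v)).
        rewrite efst_ecat. apply A.
Qed.

Lemma interp_majs W G (x y : tup W G) :
  interp (majs x y) = i_int (fun M e => emaj (evs x e) (evs y e)).
Proof.
  rewrite <- emb_majs, interp_emb. apply itp_eq, rel_ext. intros. apply evf_majs.
Qed.

Lemma monst_bd W G (x : tup W G) :
  ent (interp (And (majs x x) (sts x))) (i_bd (@g_mon W) x).
Proof.
  apply ent_and_elim. rewrite interp_majs.
  apply ent_trans with (i_imp (i_bd (@g_true W) x) (i_bd (@g_mon W) x)).
  - apply ent_curry.
    apply (@ent_intro0 G W _ _ (i_bd (@g_mon W) x) (fun M z => efst W z)); [dfn_tac|].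
    intros M e c b Mc Mb [A [_ B]]. rewrite efst_ecat. split; assumption.
  - apply ent_imp_mono; [apply sts_bd | apply ent_refl].
Qed.

Lemma bd_monst W G (x : tup W G) :
  ent (i_bd (@g_mon W) x) (interp (And (majs x x) (sts x))).
Proof.
  apply ent_and_intro.
  - rewrite interp_majs.
    apply (@ent_intro0 G W _ _ (i_int _) (fun M z => enil M)); [dfn_tac|].
    intros M e c b Mc Mb [A _]. exact A.
  - apply ent_trans with (i_bd (@g_true W) x); [|apply bd_sts].
    apply (@ent_intro0 G W _ _ (i_bd (@g_true W) x) (fun M z => efst W z)); [dfn_tac|].
    intros M e c b Mc Mb [_ A]. rewrite efst_ecat. split; [exact I | exact A].
Qed.

(** * The principles of nonstandard arithmetic *)

Definition i_some Y G (g : forall M : model, env M Y -> Prop) (phi : fm Internal (Y ++ G))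
    : itp G :=
  @Build_itp G [] Y (fun M e _ c => exists y, g M y /\ emaj y c /\ evf phi (ecat y e))
    (fun M e b c c' A E => match A with ex_intro _ y (conj A1 (conj A2 A3)) =>
       ex_intro _ y (conj A1 (conj (emaj_trans A2 E) A3)) end).
Arguments i_some Y {G} g phi.

Lemma ent_some Y G g (phi : fm Internal (Y ++ G)) S :
  ent (interp S) (i_bd g (here Y)) ->
  ent (interp (Exs Y (And S (emb phi)))) (i_some Y g phi).
Proof.
  intro HS. apply ent_exs_elim.
  apply (@ent_and_elim _ (interp S) (interp (emb phi))). rewrite interp_emb.
  eapply ent_trans; [exact HS|]. apply ent_curry.
  apply (@ent_intro0 (Y ++ G) (Y ++ []) _ _ (i_wks Y (i_some Y g phi))
    (fun M z => efst Y (efst (Y ++ []) z))); [dfn_tac|].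
  intros M e c b Mc Mb [[A1 A2] A3]. exists (efst Y e). rewrite efst_ecat.
  split; [exact A1|]. split; [exact A2|].
  change (evf phi (ecat (efst Y e) (esnd Y e))). rewrite ecat_eta. exact A3.
Qed.

Definition i_bounded X Y G (gX : forall M : model, env M X -> Prop)
    (gY : forall M : model, env M Y -> Prop) (phi : fm Internal (Y ++ X ++ G)) : itp G.
Proof.
  refine (@Build_itp G X Y (fun M e b c => forall x, gX M x -> emaj x b ->
    exists y, gY M y /\ emaj y c /\ evf phi (ecat y (ecat x e))) _).
  intros M e b c c' A E x Hx Hb. destruct (A x Hx Hb) as [y [A1 [A2 A3]]].
  exists y. split; [exact A1|]. split; [exact (emaj_trans A2 E) | exact A3].
Defined.
Arguments i_bounded X Y {G} gX gY phi.

(** A functional that takes the empty tuple of arguments is its value; this map introduces that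
    empty tuple. *)
Lemma dfn_const C : exists L : forall M : model, env M C -> env M (map (arrs []) C),
  dfn L /\ monotone_map L /\
  forall (M : model) (c : env M C), mon c -> forall b, emaj c (sfapp (L M c) b).
Proof.
  destruct (@dfn_curry [] C C (fun M e => e) (@dfn_id C)) as [L [D [Mt H]]].
  exists L. repeat split; auto. intros M c Hc b.
  apply (H M c b Hc). apply emaj_nil.
Qed.

(** The only use of the hypotheses on standard tuples is to exchange them for bounds. *)
Lemma ent_bounded X Y G gX gY (phi : fm Internal (Y ++ X ++ G)) SX SY :
  ent (i_bd gX (here X)) (interp SX) -> ent (interp SY) (i_bd gY (here Y)) ->
  ent (interp (Alls X (Imp SX (Exs Y (And SY (emb phi)))))) (i_bounded X Y gX gY phi).
Proof.
  intros HX HY. rewrite interp_Alls.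
  apply ent_trans with (i_alls X (i_imp (i_bd gX (here X)) (i_some Y gY phi))).
  { apply ent_alls. apply ent_imp_mono; [exact HX | apply ent_some, HY]. }
  destruct (dfn_const X) as [L [DL [ML HL]]].
  pose (h := i_alls X (i_imp (i_bd gX (here X)) (i_some Y gY phi))).
  apply (@ent_intro _ h (i_bounded X Y gX gY phi)
    (fun M z => ecat (L M (esnd (arg h) z)) (enil M))
    (fun M z => sfapp (efst (arg h) z) (ecat (L M (esnd (arg h) z)) (enil M)))).
  - apply (@dfn_ecat _ (map (arrs []) X) []); dfn_tac.
  - apply dfn_fapp; [dfn_tac|]. apply (@dfn_ecat _ (map (arrs []) X) []); dfn_tac.
  - intros M e z Hz A x Gx Hx.
    assert (Mb : mon (ecat (L M (esnd (arg h) z)) (enil M))).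
    { apply emaj_ecat; [apply ML, emaj_esnd, Hz | apply emaj_nil]. }
    specialize (A _ Mb Mb x). destruct A as [y [A1 [A2 A3]]].
    + intros b _ _. simpl. rewrite efst_ecat.
      change (gX M (efst X (ecat x e)) /\
        emaj (efst X (ecat x e)) (sfapp (L M (esnd (arg h) z)) b)).
      rewrite efst_ecat. split; [exact Gx|]. apply (emaj_trans Hx).
      apply HL. apply emaj_esnd, Hz.
    + exists y. auto.
Qed.

Lemma evf_ExLe (M : structure) W G (b : tup W G) (p : fm Internal (W ++ G)) (e : env M G) :
  evf (ExLe b p) e <-> exists w, emaj w (evs b e) /\ evf p (ecat w e).
Proof.
  unfold ExLe. rewrite evf_Exs. split; intros [w A]; exists w.
  - rewrite evf_And, evf_majs, evs_here, evs_up, efst_ecat, esnd_ecat in A. exact A.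
  - rewrite evf_And, evf_majs, evs_here, evs_up, efst_ecat, esnd_ecat. exact A.
Qed.

Lemma interp_eqt s G (x y : tm G s) :
  interp (eqt x y) = i_int (fun M e => evt x e = evt y e).
Proof.
  rewrite <- emb_eqt, interp_emb. apply itp_eq, rel_ext. intros. apply evf_eqt.
Qed.

Lemma interp_maj s G (x y : tm G s) :
  interp (maj x y) = i_int (fun M e => smaj (evt x e) (evt y e)).
Proof.
  rewrite <- emb_maj, interp_emb. apply itp_eq, rel_ext. intros. apply evf_maj.
Qed.

Lemma realized_EPA G (p : fm Internal G) : EPA_ax p -> realized (interp (emb p)).
Proof.
  intro A. rewrite interp_emb. apply realize with (fun (M : model) _ => enil M); [dfn_tac|].
  intros M e b _. apply mtrue, A.
Qed.

(** An internal hypothesis supplies no bound. *)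
Lemma ent_int G (P : forall M : model, env M G -> Prop) (i : itp G)
    (T : forall M : model, env M (iB i) -> env M (iC i)) : dfn T ->
  (forall (M : model) (e : env M G) b, mon b -> P M e -> iR i e b (T M b)) ->
  ent (i_int P) i.
Proof.
  intros D H.
  apply (@ent_intro0 G [] (fun M e _ _ => P M e) _ i (fun M z => T M (esnd [] z))).
  - apply (dfn_comp D). dfn_tac.
  - intros M e c b _ Hb A. rewrite esnd_ecat. auto.
Qed.

Lemma realized_st_eq G s (x y : tm G s) :
  realized (interp (Imp (eqt x y) (Imp (st x) (st y)))).
Proof.
  simpl. rewrite interp_eqt.
  apply (@ent_int G _ (i_imp (i_st x) (i_st y)) (fun M z => z)); [apply dfn_id|].
  intros M e b Hb A H. simpl. rewrite <- A. apply (H (enil M)); apply emaj_nil.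
Qed.

Lemma realized_st_maj G s (x y : tm G s) :
  realized (interp (Imp (st y) (Imp (maj x y) (st x)))).
Proof.
  simpl. rewrite interp_maj.
  apply (@ent_intro0 G [s] _ _ (i_imp (i_int _) (i_st x)) (fun M z => z)); [apply dfn_id|].
  intros M e c b Mc Mb A H. apply smaj_trans with (evt y e); [|exact A].
  apply (H (enil M)); apply emaj_nil.
Qed.

Lemma realized_st_closed G s (t : tm [] s) : realized (interp (st (cl G t))).
Proof.
  destruct (majorant t) as [t' H]. simpl.
  apply realize with (fun (M : model) _ => econs (evt t' (enil M)) (enil M)).
  - exists (scons t' (var_nil _)). intros M e.
    refine (eq_trans _ (eq_sym (evs_scons _ _ _))). f_equal; [f_equal|]; apply env_nil.
  - intros M e b _. simpl. rewrite evt_cl. apply H. apply emaj_nil.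
Qed.

Lemma realized_st_app G r s (z : tm G (r ~> s)) (x : tm G r) :
  realized (interp (Imp (st z) (Imp (st x) (st (App z x))))).
Proof.
  simpl. apply (@ent_intro0 G [r ~> s] _ _ (i_imp (i_st x) (i_st (App z x)))
    (fun M w => econs (ap (ehd w) (ehd (etl w))) (enil M))).
  - exists (scons (App (Var vz) (Var (vs _ vz))) (var_nil _)). intros M e.
    refine (eq_trans _ (eq_sym (evs_scons _ _ _))). apply f_equal, env_nil.
  - intros M e c b Mc Mb A H. apply (smaj_app (s := s)); [exact A|].
    apply (H (enil M)); apply emaj_nil.
Qed.

Lemma ent_sub G D (f : tup G D) (i j : itp G) : ent i j -> ent (i_sub f i) (i_sub f j).
Proof.
  intros [T [Dt [Mt H]]]. exists T. repeat split; auto.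
  intros M e b Hb. apply (H M (evs f e) b Hb).
Qed.

Lemma ent_wk_all G s (i : itp (s :: G)) : ent (i_wk s (i_all i)) i.
Proof.
  destruct (ent_refl (i_all i)) as [T [Dt [Mt H]]]. exists T. repeat split; auto.
  intros M e b Hb A. rewrite <- (econs_eta e). apply (H M (etl e) b Hb). exact A.
Qed.

(** External induction follows from the induction rule for the formula that has the two
    premises of the axiom as hypotheses. *)
Lemma realized_ind G (P : fm External (N :: G)) :
  realized (interp (Imp (inst P Zero)
    (Imp (All N (Imp (st (Var vz)) (Imp P (at_succ P)))) (All N (Imp (st (Var vz)) P))))).
Proof.
  simpl. unfold inst, at_succ. rewrite !interp_fsub. fold (@succ_sub G).
  set (i := interp P). set (i0 := i_sub (scons Zero ids) i). set (iS := i_sub (@succ_sub G) i).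
  set (q := i_imp (i_st (Var vz)) (i_imp i iS)).
  apply ent_curry. set (h := i_tens i0 (i_all q)).
  apply ent_allI. apply ent_curry.
  assert (R : ent (i_st (Var vz)) (i_imp (i_wk N h) i)).
  { apply ent_induction.
    - apply def_imp; [|apply def_interp]. apply def_sub, def_tens.
      + apply def_sub, def_interp.
      + apply def_all, def_imp; [apply def_st|].
        apply def_imp; [apply def_interp | apply def_sub, def_interp].
    - replace (i_sub (scons Zero ids) (i_imp (i_wk N h) i)) with (i_imp h i0).
      + apply ent_fst.
      + apply itp_eq, rel_ext. intros M e b c. simpl. rewrite !evs_scons. exact (iff_refl _).
    - replace (i_sub (@succ_sub G) (i_imp (i_wk N h) i)) with (i_imp (i_wk N h) iS).
      + apply ent_curry, ent_curry.
        assert (Q : ent (i_tens (i_tens (i_st (Var vz)) (i_imp (i_wk N h) i)) (i_wk N h)) q).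
        { eapply ent_trans; [apply ent_snd|].
          apply ent_trans with (i_wk N (i_all q)); [|apply ent_wk_all].
          apply ent_sub, ent_snd. }
        apply ent_mp with i; [|apply ent_mp with (2 := Q); apply ent_fst_trans, ent_fst].
        apply ent_mp with (i_wk N h); [apply ent_snd|].
        apply ent_fst_trans, ent_snd.
      + apply itp_eq, rel_ext. intros M e b c. simpl. unfold succ_sub.
        rewrite !evs_scons. exact (iff_refl _). }
  apply ent_mp with (i_wk N h); [apply ent_fst|].
  eapply ent_trans; [apply ent_snd | exact R].
Qed.

(** A bound of x majorizes itself, so it is also the required y. *)
Lemma realized_MAJ G s : realized (interp (MAJ G s)).
Proof.
  unfold MAJ. cbn [interp].
  assert (A : ent (i_st (Var vz)) (interp (Ex s (And (st (Var vz))
    (maj (Var (vs s vz)) (Var vz))) : fm External (s :: G)))).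
  { cbn [interp Ex And Not]. rewrite interp_maj.
    set (P := i_int _).
    set (sy := i_st (Var vz : tm (s :: s :: G) s)).
    apply ent_trans with (i_not (i_all (i_imp sy (i_not P)))).
    - apply (@ent_intro0 (s :: G) [s] _ _ (i_not (i_all (i_imp sy (i_not P))))
        (fun M z => z)); [apply dfn_id|].
      intros M e c b Mc Mb A H.
      assert (E : emaj c (efst [s] (ecat c b))) by (rewrite efst_ecat; exact Mc).
      apply (H c E Mc (ehd c)).
      + intros b' _ _. apply (Mc s vz).
      + intros b' _ _. exact A.
    - apply ent_not_mono, ent_all. apply ent_curry, ent_curry.
      apply ent_mp with (i_and sy P); [|apply ent_fst_trans, ent_fst].
      apply ent_and_intro; [apply ent_fst_trans, ent_snd | apply ent_snd]. }
  destruct A as [T [Dt [Mt H]]]. exists T. repeat split; auto.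
  intros M e b Hb x. apply (H M (econs x e) b Hb).
Qed.

(** The form (exists y <= t) phi of the matrix of choice, of realization and of the extracted
    statement; the block F lies between x and the parameters. *)
Definition upto F X Y G (t : tup Y (X ++ F ++ G)) (phi : fm Internal (Y ++ X ++ G)) :
    fm Internal (X ++ F ++ G) :=
  ExLe t (fsub (tcat (here Y) (tcat (up Y (here X)) (up Y (up X (up F ids))))) phi).
Arguments upto F X Y {G} t phi.

Lemma evf_upto (M : model) F X Y G (t : tup Y (X ++ F ++ G)) (phi : fm Internal (Y ++ X ++ G))
    (x : env M X) (f : env M F) (e : env M G) :
  evf (upto F X Y t phi) (ecat x (ecat f e)) <->
  exists y, emaj y (evs t (ecat x (ecat f e))) /\ evf phi (ecat y (ecat x e)).
Proof.
  unfold upto. rewrite evf_ExLe. split; intros [y [A B]]; exists y; split; auto.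
  - rewrite evf_fsub, !evs_tcat, !evs_up, !evs_here, !esnd_ecat, !efst_ecat in B. exact B.
  - rewrite evf_fsub, !evs_tcat, !evs_up, !evs_here, !esnd_ecat, !efst_ecat. exact B.
Qed.

Lemma emb_upto F X Y G (t : tup Y (X ++ F ++ G)) (phi : fm Internal (Y ++ X ++ G)) :
  ExLe t (fsub (tcat (here Y) (tcat (up Y (here X)) (up Y (up X (up F ids))))) (emb phi)) =
  emb (upto F X Y t phi).
Proof. unfold upto. rewrite emb_ExLe, emb_fsub. reflexivity. Qed.

Definition i_univ X G (p : fm Internal (X ++ G)) : itp G :=
  @Build_itp G X [] (fun M e b _ => forall x, mon x -> emaj x b -> evf p (ecat x e))
    (fun M e b c c' A _ => A).
Arguments i_univ X {G} p.

Lemma univ_AllMonSt X G (p : fm Internal (X ++ G)) :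
  ent (i_univ X p) (interp (AllMonSt X (emb p))).
Proof.
  unfold AllMonSt. rewrite interp_Alls. cbn [interp]. rewrite interp_emb.
  apply ent_trans with (i_alls X (i_imp (i_bd (@g_mon X) (here X)) (i_int (fun M e => evf p e)))).
  - pose (k := i_alls X (i_imp (i_bd (@g_mon X) (here X)) (i_int (fun M e => evf p e)))).
    apply (@ent_intro G (i_univ X p) k
      (fun M z => sfapp (efst (map (arrs []) X) z) (enil M)) (fun M z => enil M)).
    + apply dfn_fapp; [|dfn_tac]. apply (@dfn_efst _ (map (arrs []) X) []). dfn_tac.
    + dfn_tac.
    + intros M e z Hz A w B.
      assert (Mc : mon (sfapp (efst (map (arrs []) X) z) (enil M))).
      { apply emaj_sfapp; [|apply emaj_nil].
        apply (@emaj_efst M (map (arrs []) X) []). exact Hz. }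
      destruct (B (enil M) (@emaj_nil M _ _) (@emaj_nil M _ _)) as [C D].
      change (mon (efst X (ecat w e))) in C. change (emaj (efst X (ecat w e))
        (sfapp (efst (map (arrs []) X) z) (enil M))) in D.
      rewrite efst_ecat in C, D. apply (A _ Mc Mc); assumption.
  - apply ent_alls. apply ent_imp_mono; [apply monst_bd | apply ent_refl].
Qed.

(** The premise is interpreted by (forall~ x <= b) (exists~ y <= c) phi, so a functional f0 that
    gives c from b is a choice functional: its value at b = x bounds a y for x. *)
Lemma realized_mAC G X Y (phi : fm Internal (Y ++ X ++ G)) : realized (interp (mAC G X Y phi)).
Proof.
  unfold mAC. cbv zeta. set (F := map (arrs X) Y). rewrite emb_upto.
  set (theta := upto F X Y (fapp X Y (up X (here F)) (here X)) phi).
  change (ent (interp (AllMonSt X (ExMonSt Y (emb phi))))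
    (interp (ExMonSt F (AllMonSt X (emb theta))))).
  apply ent_trans with (i_bounded X Y (@g_mon X) (@g_mon Y) phi).
  { apply ent_bounded; [apply bd_monst | apply monst_bd]. }
  unfold ExMonSt at 1. apply ent_exs_intro.
  pose (k := i_alls F (i_imp (i_bd (@g_mon F) (here F)) (i_not (i_univ X theta)))).
  apply ent_trans with (i_not k).
  2:{ apply ent_not_mono, ent_alls. apply ent_curry, ent_curry.
      eapply ent_mp; [|apply ent_fst_trans, ent_fst].
      apply ent_and_intro.
      - apply ent_fst_trans. eapply ent_trans; [apply ent_snd | apply bd_monst].
      - eapply ent_trans; [apply ent_snd | apply univ_AllMonSt]. }
  destruct (dfn_const F) as [L [DL [ML HL]]].
  pose (h := i_bounded X Y (@g_mon X) (@g_mon Y) phi).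
  pose (c := fun (M : model) (z : env M (F ++ iB (i_not k))) =>
    ecat (L M (efst F z)) (enil M)).
  assert (Dc : dfn c).
  { apply (@dfn_ecat _ (map (arrs []) F) []); dfn_tac. }
  assert (Mc : forall (M : model) z, mon z -> mon (c M z)).
  { intros M z Hz. apply emaj_ecat; [apply ML, emaj_efst, Hz | apply emaj_nil]. }
  apply (@ent_intro G h (i_not k)
    (fun M z => efst X (sfapp (efst (arg k) (esnd F z)) (c M z)))
    (fun M z => ecat (c M z) (enil M))).
  - apply (@dfn_efst _ X []). apply dfn_fapp; [|exact Dc].
    apply (@dfn_efst _ (arg k) []). dfn_tac.
  - dfn_tac.
  - intros M e z Hz A B.
    assert (E : emaj (c M z) (efst (iB k) (ecat (c M z) (enil M)))).
    { rewrite efst_ecat. apply Mc, Hz. }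
    assert (Mf : mon (efst F z)) by apply emaj_efst, Hz.
    (* the choice functional is [efst F z] itself, and the bound for it is [c M z] *)
    apply (B (c M z) E (Mc M z Hz) (efst F z)).
    + intros b _ _. simpl.
      change (mon (efst F (ecat (efst F z) e)) /\ emaj (efst F (ecat (efst F z) e))
        (sfapp (efst (map (arrs []) F) (ecat (L M (efst F z)) (enil M))) b)).
      rewrite !efst_ecat. split; [exact Mf|]. apply HL, Mf.
    + intros b Hb Mb x Mx Hx. unfold theta. apply evf_upto.
      rewrite evs_fapp, evs_up, !evs_here, esnd_ecat, !efst_ecat.
      destruct (A x) with (x := x) as [y [Y1 [Y2 Y3]]].
      * apply (emaj_trans Hx). exact Hb.
      * exact Mx.
      * exact Mx.
      * exact Mx.
      * exists y. split; [exact Y2 | exact Y3].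
Qed.

(** The quantifier over x is not relativized to standard tuples, so the bound c that interprets
    the premise does not depend on x, and z = c will do. *)
Lemma realized_Realization G X Y (phi : fm Internal (Y ++ X ++ G)) :
  realized (interp (Realization G X Y phi)).
Proof.
  unfold Realization. rewrite emb_upto.
  set (theta := upto Y X Y (up X (here Y)) phi).
  change (ent (interp (Alls X (ExSt Y (emb phi))))
    (interp (ExMonSt Y (Alls X (emb theta))))).
  rewrite interp_Alls.
  apply ent_trans with (i_alls X (i_some Y (@g_true Y) phi)).
  { apply ent_alls. apply ent_some, sts_bd. }
  unfold ExMonSt. apply ent_exs_intro.
  pose (p := i_alls X (i_int (fun M e => evf theta e))).
  pose (k := i_alls Y (i_imp (i_bd (@g_mon Y) (here Y)) (i_not p))).
  apply ent_trans with (i_not k).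
  2:{ apply ent_not_mono, ent_alls. apply ent_curry, ent_curry.
      eapply ent_mp; [|apply ent_fst_trans, ent_fst].
      apply ent_and_intro.
      - apply ent_fst_trans. eapply ent_trans; [apply ent_snd | apply bd_monst].
      - rewrite interp_Alls, interp_emb. apply ent_snd. }
  destruct (dfn_const Y) as [L [DL [ML HL]]].
  pose (c := fun (M : model) (z : env M (Y ++ iB (i_not k))) =>
    ecat (L M (efst Y z)) (enil M)).
  assert (Dc : dfn c).
  { apply (@dfn_ecat _ (map (arrs []) Y) []); dfn_tac. }
  assert (Mc : forall (M : model) z, mon z -> mon (c M z)).
  { intros M z Hz. apply emaj_ecat; [apply ML, emaj_efst, Hz | apply emaj_nil]. }
  apply (@ent_intro0 G Y _ _ (i_not k) (fun M z => ecat (c M z) (enil M))).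
  - dfn_tac.
  - intros M e d b Md Hb A B.
    assert (Hz : mon (ecat d b)) by (apply emaj_ecat; assumption).
    assert (E : emaj (c M (ecat d b)) (efst (iB k) (ecat (c M (ecat d b)) (enil M)))).
    { rewrite efst_ecat. apply Mc, Hz. }
    apply (B _ E (Mc M _ Hz) d).
    + intros b' _ _.
      change (mon (efst Y (ecat d e)) /\ emaj (efst Y (ecat d e))
        (sfapp (efst (map (arrs []) Y) (c M (ecat d b))) b')).
      unfold c. rewrite !efst_ecat. split; [exact Md|]. apply HL, Md.
    + intros b' _ _ x. unfold theta. apply evf_upto.
      rewrite evs_up, evs_here, esnd_ecat, efst_ecat.
      destruct (A x) as [y [_ [Y2 Y3]]]. exists y. split; [exact Y2 | exact Y3].
Qed.

Lemma realized_M G (P : fm External G) : M_ax P -> realized (interp P).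
Proof.
  destruct 1 as [G P H|G X Y phi|G X Y phi|G s].
  - destruct H.
    + apply realized_EPA, H.
    + apply realized_st_eq.
    + apply realized_st_maj.
    + apply realized_st_closed.
    + apply realized_st_app.
    + apply realized_ind.
  - apply realized_mAC.
  - apply realized_Realization.
  - apply realized_MAJ.
Qed.

(** * Extraction of bounds *)

Lemma realized_of_ent G (i : itp G) : ent (i_int (fun _ _ => True)) i -> realized i.
Proof.
  intro H. destruct (ent_elim H) as [Tb [Te [_ [D [_ [_ A]]]]]].
  apply realize with Te; [exact D|]. intros M e b Hb. apply (A M e b Hb). intros; exact I.
Qed.

Lemma evs_clapp (M : model) X Y G (t : forall s, var Y s -> tm [] (arrs X s)) (b : tup X G)
    (e : env M G) s (v : var Y s) :
  evs (clapp t b) e v = sapps s (evt (t s v) (enil M)) (evs b e).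
Proof. unfold evs at 1, clapp. rewrite evt_apps, evt_cl. reflexivity. Qed.

Theorem corollary1p6 (X Y A : ctx) (psi : fm Internal (Y ++ X ++ A))
    (HM : M_proves (AllSt X (ExSt Y (emb psi)))) :
  exists t : forall s, var Y s -> tm [] (arrs X s),
    (forall s (v : var Y s), monotone (t s v)) /\
    EPA_proves
      (AllMon X (AllLe (here X) (ExLe (clapp t (up X (here X)))
        (fsub (tcat (here Y) (tcat (up Y (here X)) (up Y (up X (up X ids)))))
              psi)))).
Proof.
  apply (soundness realized_M) in HM.
  assert (R : realized (i_bounded X Y (@g_true X) (@g_true Y) psi)).
  { apply realized_of_ent. eapply ent_trans; [exact HM|].
    apply ent_bounded; [apply bd_sts | apply sts_bd]. }
  destruct R as [T [D [_ H]]].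
  destruct (@dfn_curry X [] Y (fun M z => T M (efst X z))) as [L [[l Hl] [ML HL]]].
  { apply (dfn_comp D). dfn_tac. }
  exists (fun s v => l _ (vmap (arrs X) v)). split.
  - intros s v. apply completeness. intros M e. apply evf_maj.
    specialize (ML M e e (@emaj_nil M e e)). rewrite Hl in ML. apply ML.
  - apply completeness. intros M e. unfold AllMon, AllLe.
    fold (upto X X Y (clapp (fun s v => l _ (vmap (arrs X) v)) (up X (here X))) psi).
    apply evf_Alls. intros b Hb.
    rewrite evf_majs, evs_here, efst_ecat in Hb. apply evf_Alls. intros x Hx.
    rewrite evf_majs, evs_up, !evs_here, esnd_ecat, !efst_ecat in Hx.
    apply evf_upto. destruct (H M e b Hb x I Hx) as [y [_ [Y2 Y3]]]. exists y.
    split; [|exact Y3]. apply (emaj_trans Y2). intros s v.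
    rewrite evs_clapp, evs_up, evs_here, esnd_ecat, efst_ecat.
    specialize (HL M (enil M) b (@emaj_nil M _ _) Hb s v).
    rewrite efst_ecat, Hl in HL. exact HL.
Qed.
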